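(* Let $\Phi$ be a $\mathcal{C}^1$, strictly convex and even function on $\mathbb{R}^n$ such that $\lim_{\|x\|\to\infty}\Phi(x)/\|x\|=\infty$. Assume that $\Phi\geq 0$ and $\Phi(0)=0$. Assume that $$\lim_{\alpha\to 0,\ \alpha\in[0,1]}\ \sup_{x\in\mathbb{R}^n,\ x\neq 0}\left\{(1-\alpha)\frac{\Phi^*\left(\frac{x}{1-\alpha}\right)}{\Phi^*(x)}\right\}=1,$$ and assume also that there exists $A>0$ such that $$\forall x\in\mathbb{R}^n,\quad x\cdot\nabla\Phi(x)\leq (A+1)\Phi(x).$$ Let $\mu_\Phi$ be the probability measure $d\mu_\Phi(x)=\frac{e^{-\Phi(x)}}{Z_\Phi}dx$ with $Z_\Phi=\int e^{-\Phi(x)}dx$. Then there exist $C_1,C_2\geq 0$ such that for every smooth enough function $g$ on $\mathbb{R}^n$ such that $\int e^g d\mu_\Phi=1$ and $\mathbf{Ent}_{\mu_\Phi}(e^g)\geq 1$, $$\mathbf{Ent}_{\mu_\Phi}(e^g)\leq C_1\int\Phi^*(C_2\nabla g)\,e^g\,d\mu_\Phi.$$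
   Context: $\|\cdot\|$ is the Euclidean norm on $\mathbb{R}^n$, $x\cdot z$ the Euclidean scalar product, and $dx$ Lebesgue measure. The Fenchel–Legendre transform of $\Phi$ is $\Phi^*(x)=\sup_{z\in\mathbb{R}^n}\{x\cdot z-\Phi(z)\}$. For a probability measure $\mu$, $\mathbf{Ent}_{\mu}(e^g)=\int e^g\log\frac{e^g}{\int e^g d\mu}\,d\mu$. ''Smooth enough'' is meant to include that the integrals involved exist. *)

(* Defs.v *)
From HB Require Import structures.
From mathcomp Require Import all_boot all_order all_algebra.
From mathcomp Require Import all_classical all_reals all_analysis.
From mathcomp Require Import measurable_realfun.

Set Implicit Arguments.
Unset Strict Implicit.
Unset Printing Implicit Defensive.

Import Order.TTheory GRing.Theory Num.Theory.
Import numFieldNormedType.Exports.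

Local Open Scope classical_set_scope.
Local Open Scope ring_scope.

(* The sigma-algebra on R^n is the product one, as for n.-tuple in the library;
   it contains the open sets (open_measurable_rV), so it is the Borel one. *)
Section measurable_rV.
Context {R : realType} {n : nat}.

Let coord (i : 'I_n) (x : 'rV[R]_n) : R := x ord0 i.

Let rV_set0 : g_sigma_preimage coord set0.
Proof. exact: sigma_algebra0. Qed.

Let rV_setC A : g_sigma_preimage coord A -> g_sigma_preimage coord (~` A).
Proof. exact: sigma_algebraC. Qed.

Let rV_bigcup (F : (set 'rV[R]_n)^nat) :
  (forall i, g_sigma_preimage coord (F i)) ->
  g_sigma_preimage coord (\bigcup_i (F i)).
Proof. exact: sigma_algebra_bigcup. Qed.

HB.instance Definition _ := @isMeasurable.Build default_measure_display
  'rV[R]_n (g_sigma_preimage coord) rV_set0 rV_setC rV_bigcup.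

Lemma measurable_coord_rV (i : 'I_n) :
  measurable_fun [set: 'rV[R]_n] (fun x : 'rV[R]_n => x ord0 i).
Proof.
move=> _ Y mY; rewrite setTI; apply: sub_sigma_algebra => /=.
rewrite -bigcup_seq/=; exists i => /=; first by rewrite mem_index_enum.
by exists Y => //; rewrite setTI.
Qed.

Lemma measurable_fun_rV d (T : measurableType d) (f : T -> 'rV[R]_n) :
  (forall i, measurable_fun [set: T] (fun t => f t ord0 i)) ->
  measurable_fun [set: T] f.
Proof.
move=> mf; suff H : g_sigma_preimage (fun i => coord i \o f) `<=` measurable.
  move: H; rewrite g_sigma_preimage_comp => H _ A mA.
  by apply: H; exists A.
apply: smallest_sub; first exact: sigma_algebra_measurable.
rewrite -bigcup_seq; apply: bigcup_sub => i _ A [B mB <-].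
exact: mf.
Qed.

Lemma measurable_box_rV (A : 'I_n -> set R) : (forall i, measurable (A i)) ->
  measurable [set x : 'rV[R]_n | forall i, A i (x ord0 i)].
Proof.
move=> mA.
rewrite (_ : mkset _ =
    \big[setI/setT]_(i < n) [set x : 'rV[R]_n | A i (x ord0 i)]).
  apply: bigsetI_measurable => i _.
  by have := measurable_coord_rV i measurableT (mA i); rewrite setTI.
rewrite -bigcap_seq; apply/seteqP; split => x /= xA i.
  by move=> _; exact: xA.
by apply: xA; rewrite /= mem_index_enum.
Qed.

Lemma open_measurable_rV (U : set 'rV[R]_n) : open U -> measurable U.
Proof.
move=> oU.
pose box (q : 'rV[rat]_n * nat) : set 'rV[R]_n := [set x | forall i,
  ball (ratr (q.1 ord0 i) : R) q.2.+1%:R^-1 (x ord0 i)].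
have mbox q : measurable (box q).
  apply: (measurable_box_rV
    (A := fun i => ball (ratr (q.1 ord0 i) : R) q.2.+1%:R^-1)) => i.
  exact: measurable_ball.
rewrite (_ : U = \bigcup_(q in [set q | box q `<=` U]) box q); last first.
  apply/seteqP; split => [x Ux|x [q /= qU]]; last exact: qU.
  have /nbhs_ballP[e /= e0 xeU] := open_nbhs_nbhs (conj oU Ux).
  have [k ke] : exists k : nat, (k.+1%:R^-1 : R) < e / 2.
    exists (Num.truncn (e / 2)^-1).
    by rewrite invf_plt ?posrE ?divr_gt0// truncnS_gt.
  have k0 : 0 < (k.+1%:R^-1 : R) by rewrite invr_gt0.
  have Hq i : {q : rat | ball (ratr q : R) k.+1%:R^-1 (x ord0 i)}.
    apply: cid.
    have := @rat_in_itvoo R (x ord0 i - k.+1%:R^-1) (x ord0 i + k.+1%:R^-1).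
    case=> [|q /itvP qP]; first by rewrite ltrBlDr -addrA ltrDl addr_gt0.
    exists q; apply: ball_sym; rewrite /ball /= ltr_distlC.
    by rewrite !qP.
  exists (\row_i projT1 (Hq i), k) => /=; last first.
    by move=> i; rewrite mxE /=; case: (Hq i).
  move=> y /= yq; apply: xeU; split=> // i j.
  rewrite (ord1 i).
  have := yq j; rewrite mxE; case: (Hq j) => /= q qx qy.
  apply: le_ball (ball_triangle (ball_sym qx) qy).
  by rewrite [leRHS]splitr lerD// ltW.
rewrite bigcup_mkcond; apply: countable_bigcupT_measurable => [|q].
  exact: countableP.
by case: ifP.
Qed.

End measurable_rV.

(* Lebesgue measure on R^n, by induction on n: (x, v) : R * R^n is identified
   with the row (x, v_0, ..., v_(n-1)). The value on boxes is lebesgue_rV_box. *)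
Section lebesgue_rV_def.
Context {R : realType}.

Section step.
Context (n : nat).

Definition rV_cons (p : R * 'rV[R]_n) : 'rV[R]_n.+1 := row_mx p.1%:M p.2.

Lemma rV_cons0 p : rV_cons p ord0 ord0 = p.1.
Proof.
rewrite /rV_cons (_ : ord0 = lshift n (ord0 : 'I_1)); last exact/val_inj.
by rewrite [LHS]row_mxEl mxE.
Qed.

Lemma rV_consS p i : rV_cons p ord0 (lift ord0 i) = p.2 ord0 i.
Proof.
rewrite /rV_cons (_ : lift ord0 i = rshift 1 i); last exact/val_inj.
by rewrite [LHS]row_mxEr.
Qed.

Lemma measurable_rV_cons : measurable_fun [set: R * 'rV[R]_n] rV_cons.
Proof.
apply: measurable_fun_rV => i; case: (unliftP ord0 i) => [j ->|->].
  under eq_fun do rewrite rV_consS.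
  exact: measurableT_comp (measurable_coord_rV j) measurable_snd.
under eq_fun do rewrite rV_cons0.
exact: measurable_fst.
Qed.

Context (m : {sigma_finite_measure set 'rV[R]_n -> \bar R}).

Definition lebesgue_rV_step : set 'rV[R]_n.+1 -> \bar R :=
  pushforward (@lebesgue_measure R \x m)%E rV_cons.

Let step0 : (lebesgue_rV_step set0 = 0)%E.
Proof. by rewrite /lebesgue_rV_step /pushforward preimage_set0 measure0. Qed.

Let step_ge0 A : (0 <= lebesgue_rV_step A)%E.
Proof. by rewrite /lebesgue_rV_step /pushforward; apply: measure_ge0. Qed.

Let step_sigma_additive : semi_sigma_additive lebesgue_rV_step.
Proof.
move=> F mF tF mUF; rewrite /lebesgue_rV_step /pushforward preimage_bigcup.
apply: measure_semi_sigma_additive.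
- by move=> k; rewrite -[X in measurable X]setTI; exact: measurable_rV_cons.
- apply/trivIsetP => /= i j _ _ ij; rewrite -preimage_setI.
  by move/trivIsetP : tF => /(_ _ _ _ _ ij) ->//; rewrite preimage_set0.
- by rewrite -preimage_bigcup -[X in measurable X]setTI;
    exact: measurable_rV_cons.
Qed.

HB.instance Definition _ := isMeasure.Build _ _ _ lebesgue_rV_step
  step0 step_ge0 step_sigma_additive.

Lemma lebesgue_rV_stepE (A : set R) (B : set 'rV[R]_n) :
  measurable A -> measurable B ->
  (lebesgue_rV_step [set x : 'rV[R]_n.+1 |
    A (x ord0 ord0) /\ B (\row_i x ord0 (lift ord0 i))] =
  lebesgue_measure A * m B)%E.
Proof.
move=> mA mB; rewrite -product_measure1E// /lebesgue_rV_step /pushforward.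
congr ((_ \x _)%E _); apply/seteqP; split => -[x v] /=; rewrite rV_cons0;
  rewrite (_ : \row_i _ = v) //; apply/rowP => i; by rewrite mxE rV_consS.
Qed.

Let step_sigma_finite : sigma_finite setT lebesgue_rV_step.
Proof.
have [F [TF ndF Foo]] := (sigma_finiteP _ _).1
  (sigma_finiteT (@lebesgue_measure R)).
have [G [TG ndG Goo]] := (sigma_finiteP _ _).1 (sigma_finiteT m).
pose tl (x : 'rV[R]_n.+1) : 'rV[R]_n := \row_i x ord0 (lift ord0 i).
have mtl : measurable_fun setT tl.
  apply: measurable_fun_rV => i; rewrite /tl.
  by under eq_fun do rewrite mxE; exact: measurable_coord_rV.
exists (fun k => [set x : 'rV[R]_n.+1 | F k (x ord0 ord0) /\ G k (tl x)]).
  apply/seteqP; split => // x _.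
  have [i _ Fi] : (\bigcup_k F k) (x ord0 ord0) by rewrite -TF.
  have [j _ Gj] : (\bigcup_k G k) (tl x) by rewrite -TG.
  exists (maxn i j) => //=; split.
    by move: Fi; exact/subsetPset/ndF/leq_maxl.
  by move: Gj; exact/subsetPset/ndG/leq_maxr.
move=> k; have [mFk Fk] := Foo k; have [mGk Gk] := Goo k; split.
  apply: measurableI.
    by rewrite -[X in measurable X]setTI; exact: measurable_coord_rV.
  by rewrite -[X in measurable X]setTI; exact: mtl.
by rewrite lebesgue_rV_stepE// lte_mul_pinfty// ge0_fin_numE.
Qed.

HB.instance Definition _ := Measure_isSigmaFinite.Build _ _ _ lebesgue_rV_step
  step_sigma_finite.

End step.

Fixpoint lebesgue_rV (n : nat) : {sigma_finite_measure set 'rV[R]_n -> \bar R} :=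
  match n with
  | 0 => \d_ (0 : 'rV[R]_0)
  | n'.+1 => lebesgue_rV_step (lebesgue_rV n')
  end.

Lemma lebesgue_rV_box n (A : 'I_n -> set R) : (forall i, measurable (A i)) ->
  (lebesgue_rV n [set x : 'rV[R]_n | forall i, A i (x ord0 i)] =
  \prod_(i < n) lebesgue_measure (A i))%E.
Proof.
elim: n A => [|n IH] A mA.
  rewrite big_ord0 /= diracE mem_set//= => -[]//.
rewrite big_ord_recl -IH//= -lebesgue_rV_stepE//; last first.
  exact: (measurable_box_rV (A := fun i => A (lift ord0 i))).
congr (_ _); apply/seteqP; split => x /=.
  by move=> Ax; split=> // i; rewrite mxE.
move=> [A0 AS] i; case: (unliftP ord0 i) => [j ->|->//].
by have := AS j; rewrite mxE.
Qed.

End lebesgue_rV_def.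

Section euclidean.
Context {R : realType} {n : nat}.
Implicit Types (x y z : 'rV[R]_n) (f Phi : 'rV[R]_n -> R).

Definition dot x y : R := \sum_(i < n) x ord0 i * y ord0 i.

(* The library's norm `|x| on 'rV[R]_n is the sup norm; it defines the same
   topology and the same notion of differentiability. *)
Definition enorm x : R := Num.sqrt (dot x x).

(* The filter of "||x|| tends to infinity" *)
Definition enorm_infty : set_system 'rV[R]_n :=
  filter_from [set: R] (fun M => [set x | M < enorm x]).

Definition gradient f x : 'rV[R]_n := \row_i 'D_(delta_mx ord0 i) f x.

Definition continuously_differentiable f :=
  (forall x, differentiable f x) /\ continuous (gradient f).

Definition strictly_convex f := forall x y (t : R), x != y -> 0 < t < 1 ->
  f (t *: x + (1 - t) *: y) < t * f x + (1 - t) * f y.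

Local Open Scope ereal_scope.

Definition legendre Phi x : \bar R :=
  ereal_sup [set (dot x z - Phi z)%:E | z in [set: 'rV[R]_n]].

(* gibbs Phi is a plain set function, which the library's integral accepts; it
   is a measure when Phi is continuous (gibbs_sigma_additive). *)
Definition gibbs_Z Phi : \bar R := \int[lebesgue_rV n]_x (expR (- Phi x))%:E.

Definition gibbs Phi (A : set 'rV[R]_n) : \bar R :=
  \int[lebesgue_rV n]_(x in A) ((expR (- Phi x))%:E / gibbs_Z Phi).

Lemma continuous_measurable_rV f :
  continuous f -> measurable_fun [set: 'rV[R]_n] f.
Proof.
move=> cf; apply: (measurability _ (RGenOpens.measurableE R)).
move=> _ [_ [a [b ->] <-]]; rewrite setTI; apply: open_measurable_rV.
by move/continuousP: cf; apply; exact: interval_open.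
Qed.

Let gibbs_density_ge0 Phi x : 0 <= (expR (- Phi x))%:E / gibbs_Z Phi.
Proof.
by rewrite mule_ge0 ?lee_fin ?expR_ge0// inve_ge0 integral_ge0// => y _.
Qed.

Lemma gibbs0 Phi : gibbs Phi set0 = 0.
Proof. exact: integral_set0. Qed.

Lemma gibbs_ge0 Phi A : 0 <= gibbs Phi A.
Proof. by apply: integral_ge0 => x _; exact: gibbs_density_ge0. Qed.

Lemma gibbs_sigma_additive Phi :
  continuous Phi -> semi_sigma_additive (gibbs Phi).
Proof.
move=> cPhi F mF tF mUF; rewrite /gibbs; apply: cvg_toP.
  apply: ereal_nondecreasing_is_cvgn => m k mk.
  by apply: lee_sum_nneg_natr => // i _ _; exact: gibbs_ge0.
rewrite ge0_integral_bigcup//=; apply: measurable_funTS.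
apply: emeasurable_funM; last exact: measurable_cst.
apply/measurable_EFinP/measurableT_comp => //.
by apply: measurableT_comp => //; exact: continuous_measurable_rV.
Qed.

End euclidean.

Section entropy.
Context d {T : measurableType d} {R : realType}.
Implicit Types (mu : set T -> \bar R) (f : T -> R).
Local Open Scope ereal_scope.

Definition entropy_integrand mu f (x : T) : R :=
  (f x * ln (f x / fine (\int[mu]_y (f y)%:E)))%R.

Definition entropy mu f : \bar R := \int[mu]_x (entropy_integrand mu f x)%:E.

End entropy.

(* Main.v *)
From HB Require Import structures.
Require Import Defs.
From mathcomp Require Import all_boot all_order all_algebra.
From mathcomp Require Import all_classical all_reals all_analysis.
From mathcomp Require Import measurable_realfun ring lra.

(** Write h = g - Phi, and let Q be a cube centred at the origin.
    Prekopa-Leindler, applied with weights 1 - alpha and alpha to the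
    restrictions of e^h and e^(- Phi) to Q, compares two quantities that agree
    at alpha = 0. Comparing their first-order terms gives
    (box_entropy_le_tangent)

      int_Q e^h h + M log (c / M) <= int_Q e^h K,

    where M and c are the integrals over Q of e^h and e^(- Phi), and K z is any
    upper bound of grad h z . (z - y) - Phi y over y in Q. Because Q is convex,
    the two restrictions produce no boundary term, so nothing is asked of g at
    infinity and Q can be enlarged at the very end.

    The supremum over y is governed by the conjugate Phi^* at
    grad Phi z - grad g z. By convexity this value is at most

      (1 - a) Phi^* (grad Phi z / (1 - a)) + a Phi^* (grad g z / a).

    For small a, the limit hypothesis bounds the first term by
    (1 + e) Phi^* (grad Phi z); the gradient inequality and the growth
    hypothesis bound Phi^* (grad Phi z) by z . grad Phi z - Phi z <= A Phi z.
    Thus K = - Phi + (a + e A) Phi + 2 Phi^* (grad g / a) is admissible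
    (tangent_le_legendreR): the main terms cancel exactly, which is what the
    value 1 of the limit is for. Letting Q grow, with mu the Gibbs measure,

      Ent <= (a + e A) int Phi e^g dmu + 2 int Phi^* (grad g / a) e^g dmu.

    Young's inequality (Phi / 2) e^g <= g e^g - e^g + e^(Phi / 2) bounds
    int Phi e^g dmu by the entropy plus a constant, and an entropy of at least
    1 dominates that constant. With a and e small the first term is then at
    most half of the entropy, so C1 = 4 and C2 = 1 / a work
    (entropy_le_legendre_lebesgue). *)

(** Write h = g - Phi, and let Q be a cube centred at the origin.
    Prekopa-Leindler, applied with weights 1 - alpha and alpha to the
    restrictions of e^h and e^(- Phi) to Q, compares two quantities that agree
    at alpha = 0. Comparing their first-order terms gives
    (box_entropy_le_tangent)

      int_Q e^h h + M log (c / M) <= int_Q e^h K,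

    where M and c are the integrals over Q of e^h and e^(- Phi), and K z is any
    upper bound of grad h z . (z - y) - Phi y over y in Q. Because Q is convex,
    the two restrictions produce no boundary term, so nothing is asked of g at
    infinity and Q can be enlarged at the very end.

    The supremum over y is governed by the conjugate Phi^* at
    grad Phi z - grad g z. By convexity this value is at most

      (1 - a) Phi^* (grad Phi z / (1 - a)) + a Phi^* (grad g z / a).

    For small a, the limit hypothesis bounds the first term by
    (1 + e) Phi^* (grad Phi z); the gradient inequality and the growth
    hypothesis bound Phi^* (grad Phi z) by z . grad Phi z - Phi z <= A Phi z.
    Thus K = - Phi + (a + e A) Phi + 2 Phi^* (grad g / a) is admissible
    (tangent_le_legendreR): the main terms cancel exactly, which is what the
    value 1 of the limit is for. Letting Q grow, with mu the Gibbs measure,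

      Ent <= (a + e A) int Phi e^g dmu + 2 int Phi^* (grad g / a) e^g dmu.

    Young's inequality (Phi / 2) e^g <= g e^g - e^g + e^(Phi / 2) bounds
    int Phi e^g dmu by the entropy plus a constant, and an entropy of at least
    1 dominates that constant. With a and e small the first term is then at
    most half of the entropy, so C1 = 4 and C2 = 1 / a work
    (entropy_le_legendre_lebesgue). *)

(** Write h = g - Phi, and let Q be a cube centred at the origin.
    Prekopa-Leindler, applied with weights 1 - alpha and alpha to the
    restrictions of e^h and e^(- Phi) to Q, compares two quantities that agree
    at alpha = 0. Comparing their first-order terms gives
    (box_entropy_le_tangent)

      int_Q e^h h + M log (c / M) <= int_Q e^h K,

    where M and c are the integrals over Q of e^h and e^(- Phi), and K z is any
    upper bound of grad h z . (z - y) - Phi y over y in Q. Because Q is convex,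
    the two restrictions produce no boundary term, so nothing is asked of g at
    infinity and Q can be enlarged at the very end.

    The supremum over y is governed by the conjugate Phi^* at
    grad Phi z - grad g z. By convexity this value is at most

      (1 - a) Phi^* (grad Phi z / (1 - a)) + a Phi^* (grad g z / a).

    For small a, the limit hypothesis bounds the first term by
    (1 + e) Phi^* (grad Phi z); the gradient inequality and the growth
    hypothesis bound Phi^* (grad Phi z) by z . grad Phi z - Phi z <= A Phi z.
    Thus K = - Phi + (a + e A) Phi + 2 Phi^* (grad g / a) is admissible
    (tangent_le_legendreR): the main terms cancel exactly, which is what the
    value 1 of the limit is for. Letting Q grow, with mu the Gibbs measure,

      Ent <= (a + e A) int Phi e^g dmu + 2 int Phi^* (grad g / a) e^g dmu.

    Young's inequality (Phi / 2) e^g <= g e^g - e^g + e^(Phi / 2) bounds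
    int Phi e^g dmu by the entropy plus a constant, and an entropy of at least
    1 dominates that constant. With a and e small the first term is then at
    most half of the entropy, so C1 = 4 and C2 = 1 / a work
    (entropy_le_legendre_lebesgue). *)

Set Implicit Arguments.
Unset Strict Implicit.
Unset Printing Implicit Defensive.

Import Order.TTheory GRing.Theory Num.Theory.
Import numFieldNormedType.Exports.

Local Open Scope classical_set_scope.
Local Open Scope ring_scope.

(** * Prekopa-Leindler on the line *)

Section line.
Context {R : realType}.
Notation leb := (@lebesgue_measure R).

Lemma measurable_affine (s c : R) : measurable_fun setT (fun z : R => (z - c) / s).
Proof.
have h : measurable_fun setT (fun z : R => z - c) by exact: measurable_funB.
exact: (measurable_funM h (measurable_cst _)).
Qed.

Lemma lebesgue_measure_affine (s c : R) (A : set R) : 0 < s -> measurable A ->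
  (leb ((fun z => (z - c) / s)%R @^-1` A) = s%:E * leb A)%E.
Proof.
move=> s0 mA; pose phi (z : measurableTypeR R) : measurableTypeR R := (z - c) / s.
have mphi : measurable_fun setT phi := measurable_affine s c.
have s1 : 0 <= s^-1 by rewrite invr_ge0 ltW.
pose mu1 : {measure set (measurableTypeR R) -> \bar R} :=
  mscale (NngNum s1)
    (pushforward leb phi : {measure set (measurableTypeR R) -> \bar R}).
suff -> : leb A = mu1 mphi A.
  by rewrite /mu1 /= /mscale /= muleA -EFinM mulfV ?gt_eqF// mul1e.
apply: lebesgue_measure_unique => // X [[p q] _ <-] /=.
rewrite /mu1 /mscale /= /pushforward.
have -> : phi @^-1` `]p, q] = `]s * p + c, s * q + c]%classic.
  apply/seteqP; split => z /=; rewrite !in_itv /= /phi ltr_pdivlMr// ler_pdivrMr//;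
   rewrite ltrBrDr lerBlDr ![_ * s]mulrC//.
rewrite !lebesgue_measure_itv /= !lte_fin ltrD2r ltr_pM2l//.
case: ifPn => _; last by rewrite mule0.
by rewrite -!EFinD -EFinM; congr EFin; field; rewrite gt_eqF.
Qed.

(** The set C contains a rescaled copy of A placed at a point of B close to
    inf B, and a rescaled copy of B placed at a point of A close to sup A. The
    first copy lies to the left of the second up to an overlap of length at
    most e, so their measures add up. *)
Lemma brunn_minkowski_line (a r : R) (A B C : set R) : 0 < a < 1 ->
  measurable A -> measurable B -> measurable C -> A !=set0 -> B !=set0 ->
  (forall x, A x -> `|x| <= r) -> (forall x, B x -> `|x| <= r) ->
  (forall x y, A x -> B y -> C ((1 - a) * x + a * y)) ->
  ((1 - a)%:E * leb A + a%:E * leb B <= leb C)%E.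
Proof.
move=> /andP[a0 a1] mA mB mC A0 B0 Ar Br ABC.
have b0 : 0 < 1 - a by rewrite subr_gt0.
apply/lee_addgt0Pr => e e0.
have supA : has_sup A.
  by split => //; exists r => x /Ar; rewrite ler_norml => /andP[].
have infB : has_inf B.
  by split => //; exists (- r) => x /Br; rewrite ler_norml => /andP[].
have [x0 Ax0 x0e] := sup_adherent e0 supA.
have [y0 By0 y0e] := inf_adherent e0 infB.
pose A' := (fun z => (z - a * y0) / (1 - a)) @^-1` A.
pose B' := (fun z => (z - (1 - a) * x0) / a) @^-1` B.
have mA' : measurable A'.
  rewrite /A' -[X in measurable X]setTI.
  exact: measurable_affine.
have mB' : measurable B'.
  rewrite /B' -[X in measurable X]setTI.
  exact: measurable_affine.
rewrite -(lebesgue_measure_affine (a * y0)%R b0 mA).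
rewrite -(lebesgue_measure_affine ((1 - a) * x0)%R a0 mB).
rewrite -/A' -/B' (measureDI leb mB' mA') addeA; apply: leeD; last first.
  pose p := ((1 - a) * x0 + a * inf B)%R; pose q := ((1 - a) * sup A + a * y0)%R.
  apply: (@le_trans _ _ (leb `[p, q])).
    apply: le_measure; rewrite ?inE//; first exact: measurableI.
    move=> z [Bz Az] /=; rewrite in_itv/=; apply/andP; split.
      have := ge_inf infB.2 Bz; rewrite ler_pdivlMr// => ?; rewrite /p; lra.
    have := sup_upper_bound supA Az; rewrite ler_pdivrMr// => ?; rewrite /q; lra.
  rewrite lebesgue_measure_itv/= lte_fin; case: ifPn => _; last by rewrite lee_fin ltW.
  rewrite -EFinD lee_fin /p /q.
  have h1 : (1 - a) * (sup A - x0) <= (1 - a) * e by rewrite ler_pM2l//; lra.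
  have h2 : a * (y0 - inf B) <= a * e by rewrite ler_pM2l//; lra.
  lra.
rewrite -measureU//; last 2 first.
  exact: measurableD.
  by apply/seteqP; split => // z [? []].
apply: le_measure; rewrite ?inE//.
  by apply: measurableU => //; exact: measurableD.
move=> z [Az|[Bz _]].
  by have := ABC _ _ Az By0; congr C; field; rewrite gt_eqF.
by have := ABC _ _ Ax0 Bz; congr C; field; rewrite gt_eqF.
Qed.

Lemma measurable_subgraph (u : R -> R) : measurable_fun setT u ->
  measurable [set p : R * R | p.2 < u p.1].
Proof.
move=> mu; have : measurable_fun setT (fun p : R * R => p.2 < u p.1).
  apply: measurable_fun_ltr; first exact: measurable_snd.
  exact: measurableT_comp mu measurable_fst.
by move=> /(_ measurableT [set true]); rewrite setTI; exact.
Qed.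

(** Both sides are the measure of the region under the graph of u. *)
Lemma layer_cake (u : R -> R) : measurable_fun setT u -> (forall x, 0 <= u x) ->
  (\int[leb]_x (u x)%:E =
   \int[leb]_(t in `[0%R, +oo[) leb [set x | (t < u x)%R])%E.
Proof.
move=> mu u0.
pose E : set (R * R) := [set p | 0 <= p.2 /\ p.2 < u p.1].
have mE : measurable E.
  rewrite (_ : E = (fun p : R * R => 0 <= p.2) @^-1` [set true] `&`
     [set p : R * R | p.2 < u p.1]); last by apply/seteqP; split => p.
  apply: measurableI; last exact: measurable_subgraph.
  have : measurable_fun setT (fun p : R * R => 0 <= p.2).
    by apply: measurable_fun_ler => //; exact: measurable_snd.
  by move=> /(_ measurableT [set true]); rewrite setTI; exact.
have := indic_fubini_tonelli leb leb mE.
rewrite indic_fubini_tonelli_FE// indic_fubini_tonelli_GE// => h.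
transitivity (\int[leb]_x leb (xsection E x))%E.
  apply: eq_integral => x _.
  rewrite (_ : xsection E x = `[0, u x[%classic).
    rewrite lebesgue_measure_itv/= lte_fin; case: ifPn => ux; first by rewrite oppr0 adde0.
    by apply/eqP; rewrite eqe eq_le u0 leNgt ux.
  by apply/seteqP; split => t; rewrite /xsection /= inE in_itv/= /E/= => /andP.
rewrite [LHS]h [RHS]integral_mkcond; apply: eq_integral => t _.
have -> : (leb \o ysection E) t = leb [set x | 0 <= t /\ t < u x].
  by congr (leb _); apply/seteqP; split => x /=; rewrite /ysection/= inE.
rewrite patchE; case: ifPn => /=; rewrite ?notin_setE ?inE/= in_itv/= andbT => t0.
  by congr (leb _); apply/seteqP; split => x /=; [case | split].
by rewrite (_ : mkset _ = set0) ?measure0//; apply/seteqP; split => x //= [].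
Qed.

(** Young's inequality for the conjugate exponents (1 - a)^-1 and a^-1. *)
Lemma weighted_amgm (a x y : R) : 0 < a < 1 -> 0 <= x -> 0 <= y ->
  x `^ (1 - a) * y `^ a <= (1 - a) * x + a * y.
Proof.
move=> /andP[a0 a1] x0 y0.
have b0 : 0 < 1 - a by rewrite subr_gt0.
have := @conjugate_powR R (x `^ (1 - a)) (y `^ a) (1 - a)^-1 a^-1
  (powR_ge0 _ _) (powR_ge0 _ _).
rewrite !invr_gt0 !invrK subrK -!powRrM !mulfV ?gt_eqF// !powRr1//.
by move=> /(_ b0 a0 erefl); rewrite [x * (1 - a)]mulrC [y * a]mulrC.
Qed.

Lemma bounded_support_integral_fin (u : R -> R) (M r : R) :
  measurable_fun setT u -> (forall x, 0 <= u x <= M) ->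
  (forall x, u x != 0 -> `|x| <= r) ->
  (\int[leb]_x (u x)%:E)%E \is a fin_num.
Proof.
move=> mu uM ur; apply/fin_numPlt; rewrite (@lt_le_trans _ _ 0%E)//=; last first.
  by apply: integral_ge0 => x _; rewrite lee_fin; case/andP: (uM x).
apply: (@le_lt_trans _ _ (\int[leb]_x (M * \1_(`[-r, r]%classic) x)%:E)%E).
  apply: ge0_le_integral => //.
  - by move=> x _; rewrite lee_fin; case/andP: (uM x).
  - exact/measurable_EFinP.
  - by apply/measurable_EFinP; apply: measurable_funM.
  - move=> x _; rewrite lee_fin indicE.
    have [->|/ur] := eqVneq (u x) 0.
      by rewrite mulr_ge0//; case/andP: (uM x) => /le_trans h /h.
    by rewrite ler_norml => xr; rewrite mem_set/= ?in_itv//= mulr1; case/andP: (uM x).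
have M0 : 0 <= M by case/andP: (uM 0) => /le_trans h /h.
under eq_integral do rewrite EFinM.
rewrite ge0_integralZl//; last exact/measurable_EFinP.
rewrite integral_indic// setIT /= lebesgue_measure_itv/=.
by case: ifPn => _; rewrite ?mule0// -EFinD -EFinM ltry.
Qed.

(** When u and v both have supremum 1, their superlevel sets at a level t < 1
    are all nonempty, so that Brunn-Minkowski applies to each of them; the
    layer-cake formula integrates the result over t. This normalization is why
    an arithmetic mean, stronger than the geometric one, comes out. *)
Lemma prekopa_leindler_line_sup1 (a r : R) (u v w : R -> R) : 0 < a < 1 ->
  measurable_fun setT u -> measurable_fun setT v -> measurable_fun setT w ->
  (forall x, 0 <= u x <= 1) -> (forall x, 0 <= v x <= 1) -> (forall x, 0 <= w x) ->
  (forall e, e < 1 -> exists x, e < u x) -> (forall e, e < 1 -> exists x, e < v x) ->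
  (forall x, u x != 0 -> `|x| <= r) -> (forall x, v x != 0 -> `|x| <= r) ->
  (forall x y, u x `^ (1 - a) * v y `^ a <= w ((1 - a) * x + a * y)) ->
  ((1 - a)%:E * (\int[leb]_x (u x)%:E) + a%:E * (\int[leb]_x (v x)%:E)
   <= \int[leb]_x (w x)%:E)%E.
Proof.
move=> a01 mu mv mw u01 v01 w0 u1 v1 ur vr uvw; case/andP: (a01) => a0 a1.
have b0 : 0 < 1 - a by rewrite subr_gt0.
have mset (f : R -> R) (t : R) : measurable_fun setT f -> measurable [set x : R | t < f x].
  move=> mf; rewrite -[X in measurable X]setTI (_ : mkset _ = f @^-1` `]t, +oo[).
    exact: mf.
  by apply/seteqP; split => x /=; rewrite in_itv/= andbT.
have mcnt (f : R -> R) : measurable_fun setT f -> (forall x, 0 <= f x) ->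
    measurable_fun setT (fun t : R => leb [set x | t < f x]).
  move=> mf f0; have mE := measurable_subgraph mf.
  apply: eq_measurable_fun (measurable_fun_ysection leb mE) => t _ /=.
  by congr (leb _); apply/seteqP; split => x /=; rewrite /ysection/= inE.
have layer (f : R -> R) : measurable_fun setT f -> (forall x, 0 <= f x <= 1) ->
    (\int[leb]_x (f x)%:E = \int[leb]_(t in `[0%R, 1%R[) leb [set x | (t < f x)%R])%E.
  move=> mf f01; rewrite layer_cake//; last by move=> x; case/andP: (f01 x).
  rewrite [LHS]integral_mkcond [RHS]integral_mkcond; apply: eq_integral => t _.
  rewrite !patchE !mem_setE !in_itv/= andbT; have [t0|//] := leP 0 t.
  have [//|t1] /= := ltP t 1.
  rewrite (_ : mkset _ = set0) ?measure0//; apply/seteqP; split => x //=.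
  by move=> /(le_lt_trans t1); rewrite ltNge; case/andP: (f01 x) => _ ->.
have u0 x : 0 <= u x by case/andP: (u01 x).
have v0 x : 0 <= v x by case/andP: (v01 x).
rewrite (layer u)// (layer v)// [leRHS]layer_cake//.
rewrite -!ge0_integralZl//; try (by rewrite lee_fin ltW);
  try (by apply: measurable_funTS; exact: mcnt).
rewrite -ge0_integralD//; last 4 first.
- by move=> t _; rewrite mule_ge0// lee_fin ltW.
- by apply: measurable_funTS; apply: emeasurable_funM => //; exact: mcnt.
- by move=> t _; rewrite mule_ge0// lee_fin ltW.
- by apply: measurable_funTS; apply: emeasurable_funM => //; exact: mcnt.
apply: (@le_trans _ _ (\int[leb]_(t in `[0%R, 1%R[) leb [set x | (t < w x)%R])%E); last first.
  apply: ge0_subset_integral => //.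
    by apply: measurable_funTS; exact: mcnt.
  by move=> t /=; rewrite !in_itv/= andbT => /andP[].
apply: ge0_le_integral => //.
- by move=> t _; rewrite adde_ge0// mule_ge0// lee_fin ltW.
- apply: measurable_funTS; apply: emeasurable_funD;
    by apply: emeasurable_funM => //; exact: mcnt.
- by apply: measurable_funTS; exact: mcnt.
move=> t /=; rewrite in_itv/= => /andP[t0 t1].
apply: (@brunn_minkowski_line a r) => //; try exact: mset.
- by have [x ?] := u1 _ t1; exists x.
- by have [x ?] := v1 _ t1; exists x.
- by move=> x /= tx; apply: ur; rewrite gt_eqF// (le_lt_trans t0).
- by move=> x /= tx; apply: vr; rewrite gt_eqF// (le_lt_trans t0).
move=> x y /= tx ty; apply: lt_le_trans (uvw x y).
have [->|tn0] := eqVneq t 0.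
  by rewrite mulr_gt0// powR_gt0// (le_lt_trans t0).
have tp : 0 < t by rewrite lt_neqAle eq_sym tn0.
rewrite -[ltLHS](@powRr1 _ t)// -[X in t `^ X](subrK a 1) powRD; last by rewrite tn0 implybT.
by rewrite ltr_pM// ?powR_ge0// gt0_ltr_powR// nnegrE ?ltW// (lt_trans tp).
Qed.

Lemma prekopa_leindler_line (a r M : R) (u v w : R -> R) : 0 < a < 1 ->
  measurable_fun setT u -> measurable_fun setT v -> measurable_fun setT w ->
  (forall x, 0 <= u x <= M) -> (forall x, 0 <= v x <= M) -> (forall x, 0 <= w x) ->
  (forall x, u x != 0 -> `|x| <= r) -> (forall x, v x != 0 -> `|x| <= r) ->
  (forall x y, u x `^ (1 - a) * v y `^ a <= w ((1 - a) * x + a * y)) ->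
  ((fine (\int[leb]_x (u x)%:E) `^ (1 - a) * fine (\int[leb]_x (v x)%:E) `^ a)%:E
   <= \int[leb]_x (w x)%:E)%E.
Proof.
move=> a01 mu mv mw uM vM w0 ur vr uvw; case/andP: (a01) => a0 a1.
have b0 : 0 < 1 - a by rewrite subr_gt0.
have Iw0 : (0 <= \int[leb]_x (w x)%:E)%E by apply: integral_ge0 => x _; rewrite lee_fin.
have sup_pos (f : R -> R) : (forall x, 0 <= f x <= M) -> has_sup (range f).
  by move=> fM; split; [exists (f 0); exists 0|exists M => _ [x _ <-]; case/andP: (fM x)].
have sup_ub (f : R -> R) : (forall x, 0 <= f x <= M) -> forall x, f x <= sup (range f).
  by move=> fM x; apply: sup_upper_bound; [exact: sup_pos | exists x].
have sup_ge0 (f : R -> R) : (forall x, 0 <= f x <= M) -> 0 <= sup (range f).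
  by move=> fM; apply: le_trans (sup_ub f fM 0); case/andP: (fM 0).
have sup_eq0 (f : R -> R) : (forall x, 0 <= f x <= M) -> sup (range f) = 0 ->
    fine (\int[leb]_x (f x)%:E) = 0.
  move=> fM f0; rewrite (eq_integral (cst 0%E)) ?integral0// => x _.
  congr EFin; apply/eqP; rewrite eq_le -{1}f0 sup_ub//=; by case/andP: (fM x).
have [su|su] := eqVneq (sup (range u)) 0.
  by rewrite (sup_eq0 _ uM su) powR0 ?mul0r// gt_eqF.
have [sv|sv] := eqVneq (sup (range v)) 0.
  by rewrite (sup_eq0 _ vM sv) powR0 ?mulr0// gt_eqF.
set p := sup _ in su; set q := sup _ in sv.
have p0 : 0 < p by rewrite lt_neqAle eq_sym su sup_ge0.
have q0 : 0 < q by rewrite lt_neqAle eq_sym sv sup_ge0.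
pose s := p `^ (1 - a) * q `^ a.
have s0 : 0 < s by rewrite mulr_gt0// powR_gt0.
have mscal (f : R -> R) (t : R) : measurable_fun setT f -> measurable_fun setT (fun x : R => f x / t : R).
  by move=> mf; exact: measurable_funM mf (measurable_cst _).
have nrm (f : R -> R) : (forall x, 0 <= f x <= M) -> 0 < sup (range f) ->
    (forall x, 0 <= f x / sup (range f) <= 1) /\
    (forall e, e < 1 -> exists x, e < f x / sup (range f)).
  move=> fM f0; split => [x|e e1].
    by rewrite divr_ge0 ?ler_pdivrMr ?mul1r ?sup_ub//; [case/andP: (fM x) | exact: ltW].
  have d0 : 0 < (1 - e) * sup (range f) by rewrite mulr_gt0// subr_gt0.
  have [_ [x _ <-] h] := sup_adherent d0 (sup_pos f fM).
  by exists x; rewrite ltr_pdivlMr//; move: h; rewrite mulrBl mul1r opprB addrCA subrr addr0.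
have [u01 u1] := nrm u uM p0; have [v01 v1] := nrm v vM q0.
have intS (f : R -> R) (t : R) : 0 < t -> measurable_fun setT f -> (forall x, 0 <= f x) ->
   (\int[leb]_x (f x)%:E = t%:E * \int[leb]_x (f x / t)%:E)%E.
  move=> t0 mf f0; rewrite -ge0_integralZl//.
  - by apply: eq_integral => x _; rewrite -EFinM mulrC divfK// gt_eqF.
  - by apply/measurable_EFinP; exact: mscal.
  - by move=> x _; rewrite lee_fin divr_ge0// ltW.
  - by rewrite lee_fin ltW.
have ur' x : u x / p != 0 -> `|x| <= r.
  by move=> h; apply: ur; apply: contra_neq h => ->; rewrite mul0r.
have vr' x : v x / q != 0 -> `|x| <= r.
  by move=> h; apply: vr; apply: contra_neq h => ->; rewrite mul0r.
have fu := bounded_support_integral_fin (mscal u p mu) u01 ur'.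
have fv := bounded_support_integral_fin (mscal v q mv) v01 vr'.
have u0 x : 0 <= u x by case/andP: (uM x).
have v0 x : 0 <= v x by case/andP: (vM x).
rewrite (intS _ _ p0 mu)// (intS _ _ q0 mv)// (intS _ _ s0 mw)//.
rewrite !fineM//=.
have Iu0 : 0 <= fine (\int[leb]_x (u x / p)%:E)%E.
  by apply/fine_ge0/integral_ge0 => x _; case/andP: (u01 x); rewrite lee_fin.
have Iv0 : 0 <= fine (\int[leb]_x (v x / q)%:E)%E.
  by apply/fine_ge0/integral_ge0 => x _; case/andP: (v01 x); rewrite lee_fin.
rewrite !powRM ?(ltW p0) ?(ltW q0)// mulrACA -/s EFinM lee_pmul2l//.
apply: le_trans (@prekopa_leindler_line_sup1 a r _ _ _ a01 (mscal u p mu)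
  (mscal v q mv) (mscal w s mw) u01 v01 _ u1 v1 ur' vr' _).
- rewrite -[X in (_ <= _ * X + _)%E]fineK// -[X in (_ <= _ + _ * X)%E]fineK//.
  by rewrite -!EFinM -EFinD lee_fin weighted_amgm.
- by move=> x; rewrite divr_ge0// ltW.
- move=> x y; rewrite ler_pdivlMr// mulrC; apply: le_trans (uvw x y).
  rewrite /s mulrACA -!powRM ?divr_ge0 ?(ltW p0) ?(ltW q0)//.
  by rewrite mulrC ![_ * (_ / _)]mulrC !divfK ?gt_eqF// mulrC.
Qed.

End line.

(** * Prekopa-Leindler in several dimensions *)

Section cubes.
Context {R : realType}.
Notation leb := (@lebesgue_measure R).

Definition box n (r : R) : set 'rV[R]_n := [set x | forall i, `|x ord0 i| <= r].

(** The class of functions is chosen to be stable under marginals, which carry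
    the induction on the dimension, and to keep every integral finite. *)
Definition tame n (M r : R) (u : 'rV[R]_n -> R) :=
  [/\ measurable_fun setT u, forall x, 0 <= u x <= M & forall x, u x != 0 -> box r x].

(** Fubini-Tonelli for the inductive construction of the Lebesgue measure. *)
Lemma integral_rV_cons n (f : 'rV[R]_n.+1 -> \bar R) :
  measurable_fun setT f -> (forall x, 0 <= f x)%E ->
  (\int[lebesgue_rV n.+1]_x f x =
   \int[leb]_t \int[lebesgue_rV n]_v f (rV_cons (t, v)))%E.
Proof.
move=> mf f0.
have mphi : measurable_fun [set: measurableTypeR R * 'rV[R]_n] (@rV_cons R n) :=
  @measurable_rV_cons R n.
have h := ge0_integral_pushforward mphi (leb \x lebesgue_rV n)%E measurableT mf.
transitivity (\int[pushforward (leb \x lebesgue_rV n)%E (@rV_cons R n)]_x f x)%E.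
  by [].
rewrite h; last by move=> *.
rewrite preimage_setT fubini_tonelli1//=.
exact: measurableT_comp mf mphi.
Qed.

Lemma abs_le_itv (r : R) : [set t : R | `|t| <= r] = `[-r, r]%classic.
Proof. by apply/seteqP; split => x /=; rewrite in_itv/= ler_norml. Qed.

Lemma measurable_box n r : measurable (@box n r).
Proof.
apply: (measurable_box_rV (A := fun _ : 'I_n => [set t : R | `|t| <= r])) => i.
by rewrite abs_le_itv.
Qed.

Lemma lebesgue_box_lty n r : (lebesgue_rV n (@box n r) < +oo)%E.
Proof.
rewrite (lebesgue_rV_box (A := fun _ : 'I_n => [set t : R | `|t| <= r])); last first.
  by move=> i; rewrite abs_le_itv.
suff /andP[] : (0 <= \prod_(i < n) leb [set t : R | (`|t| <= r)%R] < +oo)%E by [].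
apply: (big_ind (fun x : \bar R => 0 <= x < +oo)%E) => //.
- by rewrite lee01 ltry.
- by move=> x y /andP[x0 xoo] /andP[y0 yoo]; rewrite mule_ge0//= lte_mul_pinfty// ge0_fin_numE.
move=> i _; rewrite measure_ge0/= abs_le_itv lebesgue_measure_itv/=.
by case: ifPn; rewrite -?EFinD ltry.
Qed.

Lemma tame_integral n M r (u : 'rV[R]_n -> R) : tame M r u ->
  (0 <= \int[lebesgue_rV n]_x (u x)%:E <= M%:E * lebesgue_rV n (@box n r))%E.
Proof.
move=> [mu uM ur]; apply/andP; split.
  by apply: integral_ge0 => x _; rewrite lee_fin; case/andP: (uM x).
have M0 : 0 <= M by case/andP: (uM 0) => /le_trans h /h.
have mb := @measurable_box n r.
rewrite -[X in (_ <= _ * lebesgue_rV n X)%E]setIT -integral_indic//.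
rewrite -ge0_integralZl//; last exact/measurable_EFinP.
apply: ge0_le_integral => //.
- by move=> x _; rewrite lee_fin; case/andP: (uM x).
- exact/measurable_EFinP.
- by apply/measurable_EFinP; apply: measurable_funM.
move=> x _; rewrite -EFinM lee_fin indicE.
have [->|/ur xr] := eqVneq (u x) 0; first by rewrite mulr_ge0.
by rewrite mem_set// mulr1; case/andP: (uM x).
Qed.

Lemma tame_integral_fin n M r (u : 'rV[R]_n -> R) : tame M r u ->
  (\int[lebesgue_rV n]_x (u x)%:E)%E \is a fin_num.
Proof.
move=> ut; case/andP: (tame_integral ut) => i0 iM.
rewrite ge0_fin_numE//; apply: le_lt_trans iM _.
have [_ uM _] := ut.
have M0 : 0 <= M by case/andP: (uM 0) => /le_trans h /h.
by rewrite lte_mul_pinfty//; exact: lebesgue_box_lty.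
Qed.

Lemma tame_slice n M r (u : 'rV[R]_n.+1 -> R) t : tame M r u ->
  tame M r (fun v => u (rV_cons (t, v))).
Proof.
move=> [mu uM ur]; split.
- apply: measurableT_comp mu _; apply: measurableT_comp (@measurable_rV_cons R n) _.
  exact: measurable_fun_pair.
- by move=> v; exact: uM.
- by move=> v /ur h i; have := h (lift ord0 i); rewrite rV_consS.
Qed.

Lemma measurable_marginal n M r (u : 'rV[R]_n.+1 -> R) : tame M r u ->
  measurable_fun setT (fun t : R => fine (\int[lebesgue_rV n]_v (u (rV_cons (t, v)))%:E)).
Proof.
move=> [mu uM _]; apply: measurableT_comp => //.
apply: (@measurable_fun_fubini_tonelli_F _ _ _ _ R (lebesgue_rV n)
  (fun p => (u (rV_cons p))%:E)).
- by apply/measurable_EFinP; exact: measurableT_comp mu (@measurable_rV_cons R n).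
- by move=> p; rewrite lee_fin; case/andP: (uM (rV_cons p)).
Qed.

(** By induction on the dimension: for fixed first coordinates s and t, the
    slices of u, v and w satisfy the hypothesis, so the marginals of u, v and w
    satisfy the hypothesis on the line. *)
Lemma prekopa_leindler n (a M r : R) (u v w : 'rV[R]_n -> R) : 0 < a < 1 ->
  tame M r u -> tame M r v -> tame M r w ->
  (forall x y, u x `^ (1 - a) * v y `^ a <= w ((1 - a) *: x + a *: y)) ->
  fine (\int[lebesgue_rV n]_x (u x)%:E) `^ (1 - a) *
  fine (\int[lebesgue_rV n]_x (v x)%:E) `^ a
   <= fine (\int[lebesgue_rV n]_x (w x)%:E).
Proof.
move=> a01; elim: n u v w => [|n IH] u v w tu tv tw uvw.
  have [[mu _ _] [mv _ _] [mw _ _]] := And3 tu tv tw.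
  have i0 f : measurable_fun setT f -> (\int[lebesgue_rV 0]_x (f x)%:E = (f 0)%:E)%E.
    move=> mf; rewrite [LHS]integral_dirac//; last exact/measurable_EFinP.
    by rewrite diracT mul1e.
  rewrite !i0//=; have := uvw 0 0.
  by rewrite (_ : _ *: _ + _ = 0)// !scaler0 addr0.
have I (f : 'rV[R]_n.+1 -> R) : tame M r f -> (\int[lebesgue_rV n.+1]_x (f x)%:E =
    \int[leb]_t (fine (\int[lebesgue_rV n]_v (f (rV_cons (t, v)))%:E))%:E)%E.
  move=> tf; have [mf fM _] := tf; rewrite integral_rV_cons//; first last.
    by move=> x; rewrite lee_fin; case/andP: (fM x).
    exact/measurable_EFinP.
  apply: eq_integral => t _; rewrite fineK//.
  exact: (tame_integral_fin (tame_slice t tf)).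
have bnd (f : 'rV[R]_n.+1 -> R) : tame M r f -> forall t,
    0 <= fine (\int[lebesgue_rV n]_v (f (rV_cons (t, v)))%:E) <=
    M * fine (lebesgue_rV n (@box n r)).
  move=> tf t; have tft := tame_slice t tf.
  have /andP[h0 h1] := tame_integral tft.
  rewrite fine_ge0//= -lee_fin fineK ?(tame_integral_fin tft)// EFinM fineK//.
  by rewrite ge0_fin_numE// lebesgue_box_lty.
have supp (f : 'rV[R]_n.+1 -> R) : tame M r f -> forall t,
    fine (\int[lebesgue_rV n]_v (f (rV_cons (t, v)))%:E) != 0 -> `|t| <= r.
  move=> [_ _ fr] t; apply: contra_neqT => tr.
  rewrite (eq_integral (cst 0%E)) ?integral0// => v' _.
  congr EFin; apply/eqP; apply: contraNT tr => /fr /(_ ord0).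
  by rewrite rV_cons0.
rewrite -lee_fin [leRHS]fineK; last exact: tame_integral_fin tw.
rewrite (I u)// (I v)// (I w)//.
apply: (@prekopa_leindler_line R a r (M * fine (lebesgue_rV n (@box n r)))) => //.
- exact: measurable_marginal tu.
- exact: measurable_marginal tv.
- exact: measurable_marginal tw.
- exact: bnd.
- exact: bnd.
- by move=> t; case/andP: (bnd w tw t).
- exact: supp.
- exact: supp.
move=> s t; apply: IH; try exact: tame_slice.
move=> x y; apply: le_trans (uvw _ _) _; rewrite le_eqVlt; apply/orP; left; apply/eqP.
have cc m (b c : R) (p q : 'rV[R]_m) i :
  (b *: p + c *: q) ord0 i = b * p ord0 i + c * q ord0 i by rewrite !mxE.
congr w; apply/rowP => i; rewrite cc; case: (unliftP ord0 i) => [j ->|->].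
  by rewrite !rV_consS /= cc.
by rewrite !rV_cons0.
Qed.

End cubes.

(** * First-order form of Prekopa-Leindler on a cube *)

Section tangent.
Context {R : realType}.

(** From e^s <= (1 - s)^-1; the bound s <= 1/2 is where (1 - s)^-1 stays below
    the quadratic polynomial. *)
Lemma expR_le_quadratic (s : R) : s <= 2^-1 -> expR s <= 1 + s + 2 * s ^+ 2.
Proof.
move=> s2; have s1 : 0 < 1 - s by lra.
apply: (@le_trans _ _ (1 - s)^-1).
  rewrite -[leLHS]invrK lef_pV2 ?posrE ?invr_gt0 ?expR_gt0// -expRN.
  by have := expR_ge1Dx (- s); lra.
rewrite -div1r ler_pdivrMr//.
have -> : (1 + s + 2 * s ^+ 2) * (1 - s) = 1 + s ^+ 2 * (1 - 2 * s) by ring.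
by rewrite lerDl mulr_ge0 ?sqr_ge0//; lra.
Qed.

Lemma lebesgue_box_gt0 n (r : R) : 0 < r -> (0 < lebesgue_rV n (@box R n r))%E.
Proof.
move=> r0.
rewrite (lebesgue_rV_box (A := fun _ : 'I_n => [set t : R | `|t| <= r])); last first.
  by move=> i; rewrite abs_le_itv.
apply: (big_ind (fun x : \bar R => 0 < x)%E) => //.
- by move=> x y; exact: mule_gt0.
- move=> i _; rewrite abs_le_itv /= lebesgue_measure_itv/= lte_fin ifT; last by lra.
  by rewrite -EFinD lte_fin; lra.
Qed.

Lemma box_integrable n (r B : R) (f : 'rV[R]_n -> R) : measurable_fun setT f ->
  (forall x, box r x -> `|f x| <= B) ->
  (lebesgue_rV n).-integrable (box r) (EFin \o f).
Proof.
move=> mf fB; apply: measurable_bounded_integrable.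
- exact: measurable_box.
- exact: lebesgue_box_lty.
- exact: measurable_funTS.
- exists B; split; first exact: num_real.
  by move=> t Bt x /fB /le_trans; apply; exact: ltW.
Qed.

Lemma box_Rintegral_expR_gt0 n (r B : R) (f : 'rV[R]_n -> R) : 0 < r ->
  measurable_fun setT f -> (forall x, box r x -> `|f x| <= B) ->
  0 < \int[lebesgue_rV n]_(x in box r) expR (f x).
Proof.
move=> r0 mf fB.
have mb := @measurable_box R n r.
apply: (@lt_le_trans _ _ (\int[lebesgue_rV n]_(x in box r) expR (- B))).
  rewrite Rintegral_cst// mulr_gt0 ?expR_gt0// fine_gt0// lebesgue_box_gt0//=.
  exact: lebesgue_box_lty.
apply: le_Rintegral => //.
- by apply: (@box_integrable _ _ (expR (- B))) => // x _; rewrite ger0_norm ?expR_ge0.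
- apply: (@box_integrable _ _ (expR B)); first exact: measurableT_comp.
  move=> x /fB xB; rewrite ger0_norm ?expR_ge0// ler_expR.
  by move: xB; rewrite ler_norml => /andP[].
- by move=> x /fB; rewrite ler_expR ler_norml => /andP[].
Qed.

Lemma box_convex n (r a : R) (x y : 'rV[R]_n) : 0 <= a <= 1 -> box r x -> box r y ->
  box r ((1 - a) *: x + a *: y).
Proof.
move=> /andP[a0 a1] xr yr i; rewrite !mxE.
apply: (le_trans (ler_normD _ _)); rewrite !normrM (ger0_norm a0).
rewrite ger0_norm ?subr_ge0//.
have := ler_wpM2l a0 (yr i); have : (1 - a) * `|x ord0 i| <= (1 - a) * r.
  by rewrite ler_wpM2l ?subr_ge0.
lra.
Qed.

Lemma tame_patch n (r B : R) (f : 'rV[R]_n -> R) :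
  measurable_fun setT f -> (forall x, box r x -> f x <= B) ->
  tame (expR B) r ((expR \o f) \_ (box r)).
Proof.
move=> mf fB; split.
- apply/(measurable_restrictT _ (@measurable_box R n r)) => //.
  by apply: measurable_funTS; exact: measurableT_comp.
- move=> x; rewrite patchE; case: ifPn; rewrite ?lexx ?expR_ge0//.
  by rewrite inE => /fB xB /=; rewrite ler_expR.
- by move=> x; rewrite patchE; case: ifPn; rewrite ?inE// eqxx.
Qed.

Lemma powR_expR (x a : R) : expR x `^ a = expR (a * x).
Proof. by rewrite mulrC expRM. Qed.

(** First-order expansion of Prekopa-Leindler at a = 0. With u = e^h,
    v = e^(- V) and z = (1 - a) x + a y, one has z - y = (1 - a) (x - y), so the
    expansion of h at z gives

      (1 - a) h x - a V y <= h z + a (K z - h z + t),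

    and w z can be taken to be the exponential of the right-hand side. The left
    side of Prekopa-Leindler is M e^(a ln (c / M)) >= M + a M ln (c / M), and
    the right side is M + a int e^h (K - h) up to terms of order a t and a^2. *)
Lemma box_entropy_le_tangent n (r B M c : R) (h V K : 'rV[R]_n -> R) (p : 'rV[R]_n -> 'rV[R]_n) :
  0 < r -> measurable_fun setT h -> measurable_fun setT V -> measurable_fun setT K ->
  (forall x, box r x -> `|h x| <= B) -> (forall x, box r x -> `|V x| <= B) ->
  (forall x, box r x -> `|K x| <= B) ->
  (forall e : R, 0 < e -> exists2 d : R, 0 < d & forall (a : R) x y z, 0 < a < d -> box r x -> box r y ->
     z = (1 - a) *: x + a *: y ->
     h x <= h z + a * dot (p z) (x - y) + a * e) ->
  (forall z y, box r z -> box r y -> dot (p z) (z - y) - V y <= K z) ->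
  M = \int[lebesgue_rV n]_(x in box r) expR (h x) ->
  c = \int[lebesgue_rV n]_(x in box r) expR (- V x) ->
  \int[lebesgue_rV n]_(x in box r) (expR (h x) * h x) + M * ln (c / M) <=
  \int[lebesgue_rV n]_(x in box r) (expR (h x) * K x).
Proof.
move=> r0 mh mV mK hB VB KB hU pK ME cE.
have B0 : 0 <= B.
  have : box r (0 : 'rV[R]_n) by move=> i; rewrite mxE normr0 ltW.
  by move=> /hB; apply: le_trans.
have mb := @measurable_box R n r.
have M0 : 0 < M by rewrite ME; exact: box_Rintegral_expR_gt0 mh hB.
have mVN : measurable_fun setT (fun x => - V x) by exact: measurableT_comp.
have c0 : 0 < c by rewrite cE; apply: (box_Rintegral_expR_gt0 (B := B)) => // x /VB; rewrite normrN.
have meh : measurable_fun setT (fun x => expR (h x)) by exact: measurableT_comp.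
have ehB x : box r x -> expR (h x) <= expR B.
  by move=> /hB; rewrite ler_expR ler_norml => /andP[].
have ieh : (lebesgue_rV n).-integrable (box r) (EFin \o (fun x => expR (h x))).
  by apply: (@box_integrable _ _ (expR B)) => // x /ehB; rewrite ger0_norm ?expR_ge0.
have ieK (f : 'rV[R]_n -> R) : measurable_fun setT f ->
    (forall x, box r x -> `|f x| <= B) ->
    (lebesgue_rV n).-integrable (box r) (EFin \o (fun x => expR (h x) * f x)).
  move=> mf fB; apply: (@box_integrable _ _ (expR B * B)).
    exact: measurable_funM.
  move=> x xr; rewrite normrM ger0_norm ?expR_ge0// ler_pM ?expR_ge0//.
    exact: ehB.
  exact: fB.
set H := \int[_]_(x in _) (_ * h x); set IK := \int[_]_(x in _) (_ * K x).
pose D := 2 * B + 1.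
have D0 : 1 <= D by rewrite /D; lra.
apply/ler_addgt0Pr => e e0.
pose t := Num.min 1 (e / (4 * M)).
have t0 : 0 < t by rewrite lt_min ltr01 divr_gt0// mulr_gt0.
have t1 : t <= 1 by rewrite ge_min lexx.
have tM : t * M <= e / 4.
  have : t <= e / (4 * M) by rewrite ge_min lexx orbT.
  by rewrite ler_pdivlMr ?mulr_gt0// => ?; rewrite ler_pdivlMr//; lra.
have [d d0 hd] := hU t t0.
(* The first bound on a validates the expansion of h; the second makes the
   quadratic remainder 2 (a D)^2 at most a t. *)
pose a := Num.min (d / 2) (t / (2 * D ^+ 2)).
have DD : 1 <= D ^+ 2 by rewrite -[1](expr1n _ 2) lerXn2r// nnegrE ?(le_trans ler01).
have a0 : 0 < a.
  by rewrite lt_min !divr_gt0// mulr_gt0// (lt_le_trans ltr01).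
have ad : a < d by rewrite gt_min; apply/orP; left; lra.
have at_ : 2 * a * D ^+ 2 <= t.
  have : a <= t / (2 * D ^+ 2) by rewrite ge_min lexx orbT.
  by rewrite ler_pdivlMr ?mulr_gt0// ?(lt_le_trans ltr01)//; lra.
have aD : 2 * a * D <= 1.
  apply: le_trans (le_trans at_ t1); rewrite ler_pM2l; last lra.
  by rewrite -[leLHS]mulr1 expr2 ler_pM2l//; lra.
have a1 : a < 1.
  have : 2 * a * 1 <= 2 * a * D by rewrite ler_pM2l//; lra.
  lra.
pose s x := a * (K x - h x + t).
have ms : measurable_fun setT s.
  apply: measurable_funM => //; apply: measurable_funD => //.
  exact: measurable_funB.
have sD x : box r x -> `|s x| <= a * D.
  move=> xr; rewrite normrM gtr0_norm// ler_pM2l//.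
  by have := hB _ xr; have := KB _ xr; rewrite /D !ler_norml => /andP[] ? ? /andP[] ? ?;
    apply/andP; split; lra.
have mhs : measurable_fun setT (fun x => h x + s x) by exact: measurable_funD.
have tu : tame (expR (B + 1)) r ((expR \o h) \_ (box r)).
  by apply: tame_patch => // x /hB; rewrite ler_norml => /andP[]; lra.
have tv : tame (expR (B + 1)) r ((expR \o (fun x => - V x)) \_ (box r)).
  by apply: tame_patch => // x /VB; rewrite ler_norml => /andP[]; lra.
have tw : tame (expR (B + 1)) r ((expR \o (fun x => h x + s x)) \_ (box r)).
  apply: tame_patch => // x xr; have := hB _ xr; have := sD _ xr.
  by rewrite !ler_norml => /andP[] ? ? /andP[] ? ?; lra.
have a01 : 0 < a < 1 by rewrite a0.
have fineE (f : 'rV[R]_n -> R) :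
    fine (\int[lebesgue_rV n]_x ((expR \o f) \_ (box r) x)%:E) =
    \int[lebesgue_rV n]_(x in box r) expR (f x).
  by rewrite [RHS]Rintegral_mkcond.
have PL : M `^ (1 - a) * c `^ a <= \int[lebesgue_rV n]_(x in box r) expR (h x + s x).
  rewrite ME cE -!fineE; apply: (prekopa_leindler a01 tu tv tw).
  move=> x y; rewrite !patchE.
  case: ifPn => [|_]; last by rewrite powR0 ?mul0r ?subr_eq0 ?gt_eqF//;
    case: ifPn => // _; exact: expR_ge0.
  case: ifPn => [|_ _]; last by rewrite powR0 ?mulr0 ?gt_eqF//;
    case: ifPn => // _; exact: expR_ge0.
  rewrite !inE => yr xr; set z := (_ *: x + _ *: y).
  have zr : box r z by apply: box_convex => //; rewrite !ltW.
  rewrite mem_set//= !powR_expR -expRD ler_expR.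
  have := hd a x y z; rewrite a0 ad => /(_ isT xr yr erefl) h1.
  have := pK z y zr yr.
  have -> : z - y = (1 - a) *: (x - y).
    by apply/rowP => i; rewrite /z !mxE; ring.
  have -> : dot (p z) ((1 - a) *: (x - y)) = (1 - a) * dot (p z) (x - y).
    by rewrite /dot mulr_sumr; apply: eq_bigr => i _; rewrite !mxE; ring.
  move: h1; set q := dot _ _ => h1 h2; rewrite /s.
  have h3 : (1 - a) * h x <= (1 - a) * (h z + a * q + a * t).
    by rewrite ler_pM2l//; lra.
  have h4 : a * ((1 - a) * q - V y) <= a * K z by rewrite ler_pM2l.
  have h5 : 0 <= a * (a * t) by rewrite !mulr_ge0// ltW.
  lra.
have L : M + a * (M * ln (c / M)) <= M `^ (1 - a) * c `^ a.
  have -> : M `^ (1 - a) * c `^ a = M * expR (a * ln (c / M)).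
    rewrite -{1}(lnK M0) -{1}(lnK c0) !powR_expR -expRD -[M in RHS](lnK M0) -expRD.
    by congr expR; rewrite !lnK// ln_div//; ring.
  rewrite mulrCA -{1}[M]mulr1 -mulrDr ler_pM2l//.
  exact: expR_ge1Dx.
have Rt : \int[lebesgue_rV n]_(x in box r) expR (h x + s x) <=
   M + a * (IK - H) + a * t * M + 2 * (a * D) ^+ 2 * M.
  pose k := 1 + a * t + 2 * (a * D) ^+ 2.
  have ik : (lebesgue_rV n).-integrable (box r) (EFin \o (fun x => expR (h x) * k)).
    by apply: eq_integrable (integrableZr mb k ieh).
  have id : (lebesgue_rV n).-integrable (box r)
      (EFin \o (fun x => expR (h x) * K x - expR (h x) * h x)).
    by apply: eq_integrable (integrableB mb (ieK _ mK KB) (ieK _ mh hB)).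
  have iad : (lebesgue_rV n).-integrable (box r)
      (EFin \o (fun x => a * (expR (h x) * K x - expR (h x) * h x))).
    by apply: eq_integrable (integrableZl mb a id).
  have -> : M + a * (IK - H) + a * t * M + 2 * (a * D) ^+ 2 * M =
      \int[lebesgue_rV n]_(x in box r)
       (expR (h x) * k + a * (expR (h x) * K x - expR (h x) * h x)).
    rewrite RintegralD// RintegralZr// RintegralZl// RintegralB//; try exact: ieK.
    by rewrite -ME -/H -/IK /k; ring.
  apply: le_Rintegral => //.
  - apply: (@box_integrable _ _ (expR (B + 1))); first exact: measurableT_comp.
    move=> x xr; rewrite ger0_norm ?expR_ge0// ler_expR.
    by have := hB _ xr; have := sD _ xr; rewrite !ler_norml => /andP[] ? ? /andP[] ? ?; lra.
  - by apply: eq_integrable (integrableD mb ik iad).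
  move=> x xr; have := sD _ xr; rewrite ler_norml => /andP[s1 s2].
  rewrite expRD.
  have -> : expR (h x) * k + a * (expR (h x) * K x - expR (h x) * h x) =
     expR (h x) * (1 + s x + 2 * (a * D) ^+ 2) by rewrite /k /s; ring.
  rewrite ler_pM2l ?expR_gt0//; apply: (le_trans (expR_le_quadratic _)); first lra.
  rewrite lerD2l ler_pM2l// -[leLHS]real_normK ?num_real// lerXn2r ?nnegrE ?sD//.
  by rewrite mulr_ge0//; lra.
have : a * (H + M * ln (c / M)) <= a * (IK + e).
  have h1 : a * (t * M) <= a * (e / 4) by rewrite ler_pM2l.
  have h2 : a * (2 * a * D ^+ 2 * M) <= a * (t * M).
    by rewrite ler_pM2l// ler_pM2r.
  have h3 : 0 < a * e by rewrite mulr_gt0.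
  have h4 := le_trans L (le_trans PL Rt).
  have E1 : 2 * (a * D) ^+ 2 * M = a * (2 * a * D ^+ 2 * M) by ring.
  have E2 : a * t * M = a * (t * M) by ring.
  rewrite E1 E2 in h4; lra.
by rewrite ler_pM2l.
Qed.

End tangent.

(** * Differential calculus on row vectors *)

Section calculus.
Context {R : realType} {n : nat}.
Implicit Types (f g : 'rV[R]_n -> R) (x y z v : 'rV[R]_n).

Lemma dotC x y : dot x y = dot y x.
Proof. by apply: eq_bigr => i _; rewrite mulrC. Qed.

Lemma dotDl x y z : dot (x + y) z = dot x z + dot y z.
Proof. by rewrite /dot -big_split; apply: eq_bigr => i _; rewrite !mxE mulrDl. Qed.

Lemma dotZl (a : R) x y : dot (a *: x) y = a * dot x y.
Proof. by rewrite /dot mulr_sumr; apply: eq_bigr => i _; rewrite !mxE mulrA. Qed.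

Lemma dotNl x y : dot (- x) y = - dot x y.
Proof. by rewrite -scaleN1r dotZl mulN1r. Qed.

Lemma dotBl x y z : dot (x - y) z = dot x z - dot y z.
Proof. by rewrite dotDl dotNl. Qed.

Lemma dotDr x y z : dot z (x + y) = dot z x + dot z y.
Proof. by rewrite dotC dotDl !(dotC z). Qed.

Lemma dotZr (a : R) x y : dot x (a *: y) = a * dot x y.
Proof. by rewrite dotC dotZl dotC. Qed.

Lemma dotNr x y : dot x (- y) = - dot x y.
Proof. by rewrite dotC dotNl dotC. Qed.

Lemma dotBr x y z : dot z (x - y) = dot z x - dot z y.
Proof. by rewrite dotDr dotNr. Qed.

Lemma dot_le_box (d r : R) x y : 0 <= d -> box d x -> box r y ->
  dot x y <= n%:R * (d * r).
Proof.
move=> d0 xd yr; rewrite -[n in n%:R]card_ord -sum1_card natr_sum mulr_suml.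
apply: ler_sum => i _; rewrite mul1r; apply: (le_trans (ler_norm _)).
by rewrite normrM ler_pM.
Qed.

(** The gradient is defined through partial derivatives; only for
    differentiable functions does it give all the directional ones. *)
Lemma derive_dot f x v : differentiable f x -> 'D_v f x = dot (gradient f x) v.
Proof.
move=> df; rewrite deriveE// {1}(row_sum_delta v) linear_sum /dot.
by apply: eq_bigr => i _; rewrite linearZ /= mxE -deriveE// mulrC.
Qed.

Lemma is_derive_line f x v (t : R) : (forall z, differentiable f z) ->
  is_derive t 1 (fun s : R => f (x + s *: v)) (dot (gradient f (x + t *: v)) v).
Proof.
move=> df; have E : (fun h : R => h^-1 *: (f (x + (h *: 1 + t) *: v) - f (x + t *: v))) =
    (fun h : R => h^-1 *: (f (h *: v + (x + t *: v)) - f (x + t *: v))).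
  apply/funext => h; congr (_ *: (f _ - _)).
  by rewrite scalerDl addrCA [h *: 1]mulr1.
have dv : derivable f (x + t *: v) v by exact: diff_derivable.
split.
  by rewrite /derivable [X in cvg (X @ _)]E.
by rewrite -(derive_dot v (df (x + t *: v))) /derive [X in lim (X @ _) = _]E.
Qed.

Lemma box_compact (r : R) : compact (@box R n r).
Proof.
have := @rV_compact R n (fun=> `[- r, r]%classic) (fun=> @segment_compact _ _ _).
congr compact; apply/seteqP; split => x /= h i; have := h i;
  by rewrite /= in_itv/= ler_norml.
Qed.

Lemma continuous_box_bounded f (r : R) : continuous f ->
  exists B, forall x, box r x -> `|f x| <= B.
Proof.
move=> cf; have : compact (f @` box r).
  by apply: continuous_compact; [exact: continuous_subspaceT|exact: box_compact].
move=> /compact_bounded[B [_ hB]]; exists (B + 1) => x xr.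
by apply: hB; [rewrite ltrDl|exists x].
Qed.

(** Heine-Cantor on the cube; y itself may lie outside of it. *)
Lemma continuous_box_uniform (G : 'rV[R]_n -> 'rV[R]_n) (r e : R) : continuous G -> 0 < e ->
  exists2 d, 0 < d & forall x y, box r x -> box d (y - x) -> box e (G y - G x).
Proof.
move=> cG e0; have cov := (compact_near_coveringP _).1 (@box_compact r).
have : \forall d \near 0^'+, box r `<=` (fun x => forall y, box d (y - x) -> box e (G y - G x)).
  apply: cov => x xr.
  have e2 : 0 < e / 2 by rewrite divr_gt0.
  have /cvg_ballP /(_ _ e2) /nbhs_ballP[d /= d0 hd] := cG x.
  exists (ball x (d / 2), [set t : R | t < d / 2]) => /=.
    split; first by apply: nbhsx_ballx; rewrite divr_gt0.
    by apply: nbhs_right_lt; rewrite divr_gt0.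
  move=> [x' t] /= [xx' td] y yx' i.
  have Gx' : ball (G x) (e / 2) (G x').
    by apply: hd; apply: le_ball xx'; lra.
  have Gy : ball (G x) (e / 2) (G y).
    apply: hd; split=> // j k; have := xx'.2 j k; have := yx' k.
    rewrite (ord1 j) !mxE /ball /= => h1 h2.
    have -> : x ord0 k - y ord0 k = (x ord0 k - x' ord0 k) - (y ord0 k - x' ord0 k) by ring.
    by apply: (le_lt_trans (ler_normB _ _)); lra.
  have := Gx'.2 ord0 i; have := Gy.2 ord0 i; rewrite /ball /= !mxE => h1 h2.
  have -> : G y ord0 i - G x' ord0 i = (G x ord0 i - G x' ord0 i) - (G x ord0 i - G y ord0 i) by ring.
  by apply: (le_trans (ler_normB _ _)); lra.
move=> H; have [d [hd d0]] :=
  @filter_ex _ (0 : R)^'+ _ _ (filterI H (nbhs_right_gt (0 : R))).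
by exists d => // x y xr; apply: hd.
Qed.

(** By the mean value theorem on the segment from z to x, whose length is of
    order a, and the uniform continuity of the gradient. *)
Lemma C1_uniform_expansion f (r e : R) : continuously_differentiable f -> 0 < r -> 0 < e ->
  exists2 d : R, 0 < d & forall (a : R) x y z, 0 < a < d -> box r x -> box r y ->
    z = (1 - a) *: x + a *: y ->
    `|f x - f z - a * dot (gradient f z) (x - y)| <= a * e.
Proof.
move=> [df cf] r0 e0.
pose e' := e / (n%:R * (2 * r) + 1).
have q0 : 0 < n%:R * (2 * r) + 1 :> R.
  by rewrite ltr_wpDl// mulr_ge0// mulr_ge0// ltW.
have e'0 : 0 < e' by rewrite divr_gt0.
have [d d0 hd] := continuous_box_uniform r cf e'0.
exists (Num.min 1 (d / (2 * r))).
  by rewrite lt_min ltr01 divr_gt0// mulr_gt0.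
move=> a x y z /andP[a0]; rewrite lt_min => /andP[a1 ad] xr yr zE.
have zr : box r z by rewrite zE; apply: box_convex => //; rewrite !ltW.
have xz : x - z = a *: (x - y) by apply/rowP => i; rewrite zE !mxE; ring.
have dxy : box (2 * r) (x - y).
  move=> i; rewrite !mxE (le_trans (ler_normB _ _))//.
  by have := xr i; have := yr i; lra.
pose F (s : R) := f (z + s *: (x - z)).
have dF (s : R) : is_derive s 1 F (dot (gradient f (z + s *: (x - z))) (x - z)).
  exact: is_derive_line.
have cF : {within `[0, 1], continuous F}.
  apply: derivable_within_continuous => s _; exact: (@ex_derive _ _ _ _ _ _ _ (dF s)).
have [t t01] := MVT ltr01 (fun s _ => dF s) cF.
have Ez : z + (x - z) = x by rewrite addrC subrK.
rewrite /F subr0 mulr1 scale1r scale0r addr0 Ez => ->.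
rewrite xz !dotZr -mulrBr normrM gtr0_norm// ler_pM2l// -dotBl.
have h : box e' (gradient f (z + t *: (a *: (x - y))) - gradient f z).
  apply: hd => // i; rewrite addrAC subrr add0r !mxE.
  move: t01; rewrite in_itv/= => /andP[t0 t1].
  have := dxy i; rewrite !mxE => hh.
  rewrite !normrM (gtr0_norm t0) (gtr0_norm a0).
  apply: (@le_trans _ _ (1 * (a * (2 * r)))).
    apply: ler_pM; [exact: ltW| |exact: ltW|by rewrite ler_pM2l].
    by rewrite mulr_ge0// ltW.
  by rewrite mul1r -ler_pdivlMr ?mulr_gt0// ltW.
have hN : box e' (- (gradient f (z + t *: (a *: (x - y))) - gradient f z)).
  by move=> i; have := h i; rewrite mxE [in X in _ -> X]mxE normrN !mxE.
have e'e : n%:R * (e' * (2 * r)) <= e.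
  have -> : n%:R * (e' * (2 * r)) = e' * (n%:R * (2 * r)) by ring.
  by rewrite /e' mulrAC ler_pdivrMr// ler_pM2l// lerDl.
rewrite ler_norml; apply/andP; split; last first.
  by apply: le_trans e'e; apply: dot_le_box => //; exact: ltW.
by rewrite lerNl -dotNl; apply: le_trans e'e; apply: dot_le_box => //; exact: ltW.
Qed.

End calculus.

(** * A superlinear potential and its conjugate *)

Section potential.
Context {R : realType} {n : nat} (Phi : 'rV[R]_n -> R).
Implicit Types (x y z w q : 'rV[R]_n).

Lemma coord_le_enorm x i : `|x ord0 i| <= enorm x.
Proof.
rewrite -sqrtr_sqr ler_sqrt /dot; last by apply: sumr_ge0 => j _; rewrite -expr2 sqr_ge0.
rewrite (bigD1 i)//= -expr2 lerDl; apply: sumr_ge0 => j _.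
by rewrite -expr2 sqr_ge0.
Qed.

Lemma superlinear_growth : (forall x, 0 <= Phi x) ->
  Phi x / enorm x @[x --> enorm_infty] --> +oo ->
  forall c : R, 0 <= c -> exists2 m, 0 <= m & forall z, c * enorm z <= Phi z + m.
Proof.
move=> Phi_ge0 Phi_superlinear c c0.
have [M _ hM] := Phi_superlinear _ (nbhs_pinfty_ge (num_real c)).
exists (c * Num.max M 0); first by rewrite mulr_ge0// le_max lexx orbT.
move=> z; have [zM|zM] := leP (enorm z) (Num.max M 0).
  by rewrite ler_wpDl// ler_wpM2l.
move: zM; rewrite gt_max => /andP[zM z0].
have := hM z zM; rewrite /=; rewrite ler_pdivlMr// => h.
by rewrite ler_wpDr// mulr_ge0// le_max lexx orbT.
Qed.

(** The point x is moved slightly away from y, to x', so that x divides the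
    segment from x' to y with weights 1 - a and a. Convexity at x and the
    expansion of Phi at x, taken towards x', give the inequality up to an
    arbitrary e. *)
Lemma gradient_inequality : continuously_differentiable Phi -> strictly_convex Phi ->
  forall x y, Phi x + dot (gradient Phi x) (y - x) <= Phi y.
Proof.
move=> Phi_C1 Phi_convex x y; have [->|xy] := eqVneq y x.
  by rewrite subrr -(scale0r x) dotZr mul0r addr0.
apply/ler_addgt0Pr => e e0.
pose r0 := enorm x + enorm y + 1.
have xr i : `|x ord0 i| <= r0.
  rewrite (le_trans (coord_le_enorm x i))// /r0 -addrA lerDl.
  by rewrite addr_ge0// sqrtr_ge0.
have yr i : `|y ord0 i| <= r0.
  rewrite (le_trans (coord_le_enorm y i))// /r0 addrAC lerDr.
  by rewrite addr_ge0// sqrtr_ge0.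
have r00 : 0 < r0 by rewrite ltr_wpDl// addr_ge0// sqrtr_ge0.
(* The cube of size 3 r0 also contains x', because a <= 1/2. *)
have r30 : 0 < 3 * r0 by rewrite mulr_gt0.
have [d d0 hd] := C1_uniform_expansion Phi_C1 r30 e0.
pose a := Num.min 2^-1 (d / 2).
have a0 : 0 < a by rewrite lt_min invr_gt0 ltr0n divr_gt0.
have a2 : a <= 2^-1 by rewrite ge_min lexx.
have ad : a < d by rewrite gt_min; apply/orP; right; lra.
have a1 : 0 < 1 - a by lra.
pose x' := (1 - a)^-1 *: (x - a *: y).
have xE : x = (1 - a) *: x' + a *: y.
  by rewrite /x' scalerA mulfV ?gt_eqF// scale1r subrK.
have x'r : box (3 * r0) x'.
  move=> i; rewrite !mxE normrM gtr0_norm ?invr_gt0// mulrC ler_pdivrMr//.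
  rewrite (le_trans (ler_normB _ _))// normrM (gtr0_norm a0).
  have : a * `|y ord0 i| <= 2^-1 * r0 by rewrite ler_pM// ltW.
  have : 2^-1 * (3 * r0) <= (1 - a) * (3 * r0) by rewrite ler_pM2r//; lra.
  by have := xr i; lra.
have yr3 : box (3 * r0) y by move=> i; have := yr i; lra.
have := hd a x' y x; rewrite a0 ad => /(_ isT x'r yr3 xE).
have E : dot (gradient Phi x) (x' - y) = - (dot (gradient Phi x) (y - x) / (1 - a)).
  have -> : x' - y = - (1 - a)^-1 *: (y - x).
    by apply/rowP => i; rewrite /x' !mxE; field; rewrite gt_eqF.
  by rewrite dotZr mulNr mulrC.
rewrite E; set q := dot _ (y - x); rewrite ler_norml => /andP[_ h1].
have x'y : x' != y.
  apply: contra_neq xy => x'y; rewrite xE x'y -scalerDl subrK scale1r//.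
have := Phi_convex x' y (1 - a) x'y; rewrite a1 ltrBlDr ltrDl a0 => /(_ isT).
rewrite opprB addrCA subrr addr0 -xE => h2.
have h3 : (1 - a) * (Phi x' - Phi x - a * - (q / (1 - a))) <= (1 - a) * (a * e).
  by rewrite ler_pM2l.
have h4 : (1 - a) * (Phi x' - Phi x - a * - (q / (1 - a))) =
    (1 - a) * Phi x' - (1 - a) * Phi x + a * q by field; rewrite gt_eqF.
have h5 : (1 - a) * (a * e) <= a * e by rewrite ger_pMl ?mulr_gt0//; lra.
rewrite -(ler_pM2l a0).
rewrite h4 in h3; lra.
Qed.

Lemma legendre_ub x z : ((dot x z - Phi z)%:E <= legendre Phi x)%E.
Proof. by apply: ereal_sup_ubound; exists z. Qed.

Lemma legendre_le x (b : \bar R) : (forall z, ((dot x z - Phi z)%:E <= b)%E) ->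
  (legendre Phi x <= b)%E.
Proof. by move=> h; apply: ge_ereal_sup => _ [z _ <-]. Qed.

Context (Phi_even : forall x, Phi (- x) = Phi x).
Context (Phi_ge0 : forall x, 0 <= Phi x).
Context (Phi0 : Phi 0 = 0).
Context (Phi_superlinear : Phi x / enorm x @[x --> enorm_infty] --> +oo).

Lemma legendre_ge0 x : (0 <= legendre Phi x)%E.
Proof.
apply: le_trans (legendre_ub x 0); rewrite Phi0 subr0 -(scale0r (0 : 'rV_n)).
by rewrite dotZr mul0r.
Qed.

Lemma legendre_box_bounded (r : R) : 0 <= r -> exists B : R,
  forall x, box r x -> (legendre Phi x <= B%:E)%E.
Proof.
move=> r0; have c0 : 0 <= n%:R * r by rewrite mulr_ge0.
have [m m0 hm] := superlinear_growth Phi_ge0 Phi_superlinear c0.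
exists m => x xr; apply: legendre_le => z; rewrite lee_fin.
have := hm z; have : dot x z <= n%:R * (r * enorm z); last by rewrite mulrA; lra.
by apply: dot_le_box => // i; exact: coord_le_enorm.
Qed.

(** Under the standing assumptions the conjugate is finite everywhere
    (legendreRE), and the estimates are carried out on real numbers. *)
Definition legendreR x := fine (legendre Phi x).

Lemma legendreRE x : legendre Phi x = (legendreR x)%:E.
Proof.
rewrite fineK// ge0_fin_numE ?legendre_ge0//.
have r0 : 0 <= enorm x by exact: sqrtr_ge0.
have [B hB] := legendre_box_bounded r0.
by apply: le_lt_trans (hB x _) (ltry _) => i; exact: coord_le_enorm.
Qed.

Lemma legendreR_ge0 x : 0 <= legendreR x.
Proof. by rewrite -lee_fin -legendreRE legendre_ge0. Qed.

Lemma legendreR_ub x z : dot x z - Phi z <= legendreR x.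
Proof. by rewrite -lee_fin -legendreRE legendre_ub. Qed.

Lemma legendreR_le x b : (forall z, dot x z - Phi z <= b) -> legendreR x <= b.
Proof. by move=> h; rewrite -lee_fin -legendreRE; apply: legendre_le => z; rewrite lee_fin. Qed.

Lemma legendreR0 : legendreR 0 = 0.
Proof.
apply/eqP; rewrite eq_le legendreR_ge0 andbT; apply: legendreR_le => z.
by rewrite -(scale0r (0 : 'rV_n)) dotZl mul0r sub0r oppr_le0.
Qed.

Lemma legendreRN x : legendreR (- x) = legendreR x.
Proof.
have h y : legendreR (- y) <= legendreR y.
  by apply: legendreR_le => z; rewrite dotNl -dotNr -[Phi z]Phi_even legendreR_ub.
by apply/eqP; rewrite eq_le h -{1}(opprK x) h.
Qed.

Context (Phi_C1 : continuously_differentiable Phi).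
Context (Phi_convex : strictly_convex Phi).

Lemma convex_scale (a : R) z : 0 < a < 1 -> Phi (a *: z) <= a * Phi z.
Proof.
move=> a01; have [->|z0] := eqVneq z 0; first by rewrite scaler0 Phi0 mulr0.
by have := Phi_convex z0 a01; rewrite scaler0 addr0 Phi0 mulr0 addr0; exact: ltW.
Qed.

Lemma legendreR_gradient z : legendreR (gradient Phi z) <= dot (gradient Phi z) z - Phi z.
Proof.
apply: legendreR_le => y; have := gradient_inequality Phi_C1 Phi_convex z y.
by rewrite dotBr; lra.
Qed.

(** The cancellation at the heart of the proof. The terms in y are split as a
    convex combination with weights 1 - a and a, bounded by the conjugate at
    grad Phi z / (1 - a) and at - q / a; the first one is at most
    (1 + e) (z . grad Phi z - Phi z), which added to - grad Phi z . z leaves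
    - Phi z, up to e A Phi z. The remaining q . z is (q / a) . (a z), at most
    Phi^* (q / a) + a Phi z. *)
Lemma tangent_le_legendreR (a e A : R) (q z y : 'rV[R]_n) : 0 < a < 1 -> 0 <= e ->
  (forall w, (1 - a) * legendreR ((1 - a)^-1 *: w) <= (1 + e) * legendreR w) ->
  (forall x, dot x (gradient Phi x) <= (A + 1) * Phi x) ->
  dot (q - gradient Phi z) (z - y) - Phi y <=
  - Phi z + (a + e * A) * Phi z + 2 * legendreR (a^-1 *: q).
Proof.
move=> a01 e0 ha hA; have /andP[a0 a1] := a01; set G := gradient Phi z.
have a'0 : 0 < 1 - a by lra.
have h1 : dot G y - dot q y - Phi y <= (1 - a) * legendreR ((1 - a)^-1 *: G) + a * legendreR (a^-1 *: q).
  have := legendreR_ub ((1 - a)^-1 *: G) y; rewrite dotZl -(ler_pM2l a'0) => h.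
  have := legendreR_ub (- (a^-1 *: q)) y; rewrite legendreRN dotNl dotZl -(ler_pM2l a0) => h'.
  have E1 : (1 - a) * ((1 - a)^-1 * dot G y - Phi y) = dot G y - (1 - a) * Phi y.
    by field; rewrite gt_eqF.
  have E2 : a * (- (a^-1 * dot q y) - Phi y) = - dot q y - a * Phi y.
    by field; rewrite gt_eqF.
  rewrite E1 in h; rewrite E2 in h'; lra.
have h2 : a * legendreR (a^-1 *: q) <= legendreR (a^-1 *: q).
  by rewrite ler_piMl ?legendreR_ge0// ltW.
have h3 := ha G.
have h4 : (1 + e) * legendreR G <= (1 + e) * (dot G z - Phi z).
  by rewrite ler_wpM2l ?addr_ge0//; exact: legendreR_gradient.
have h5 : e * (dot G z - Phi z) <= e * (A * Phi z).
  by rewrite ler_wpM2l//; have := hA z; rewrite dotC; lra.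
have h6 : dot q z <= legendreR (a^-1 *: q) + a * Phi z.
  have := legendreR_ub (a^-1 *: q) (a *: z); have := convex_scale z a01.
  rewrite dotZl dotZr mulrA mulVf ?gt_eqF// mul1r; lra.
rewrite dotBl !dotBr; lra.
Qed.

(** The form in which the limit hypothesis enters the proof. If the conjugate vanishes at w,
    the quotient is infinite unless its numerator vanishes, so the inequality
    holds there too. *)
Lemma legendreR_dilation (e b : R) : 0 < e -> 0 < b ->
    ereal_sup [set ((1 - alpha)%:E *
                      legendre Phi ((1 - alpha)^-1 *: x) / legendre Phi x)%E
              | x in [set x : 'rV[R]_n | x != 0]]
      @[alpha --> within `[0, 1] (nbhs (0 : R))] --> 1%:E ->
  exists a, [/\ 0 < a < 1, a <= b &
    forall w, (1 - a) * legendreR ((1 - a)^-1 *: w) <= (1 + e) * legendreR w].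
Proof.
move=> e0 b0 lim.
have : ereal_nbhs 1%:E (fun u : \bar R => (u < (1 + e)%:E)%E).
  by apply: open_ereal_lt'; rewrite lte_fin ltrDl.
move=> /lim /= /nbhs_ballP [d /= d0 hd].
pose a := Num.min (d / 2) (Num.min b 2^-1).
have a0 : 0 < a by rewrite !lt_min b0 invr_gt0 ltr0n divr_gt0.
have ad : a <= d / 2 by rewrite ge_min lexx.
have ab : a <= b by rewrite !ge_min lexx orbT.
have a2 : a <= 2^-1 by rewrite !ge_min lexx !orbT.
exists a; split=> [||w]; [by apply/andP; split=> //; lra|by []|].
have [->|w0] := eqVneq w 0; first by rewrite scaler0 legendreR0 !mulr0.
have /(_ _ _)/ltW := hd a.
rewrite /ball /= sub0r normrN gtr0_norm// in_itv/= => /(_ _ _).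
move=> h; have {}h := h ltac:(lra) ltac:(apply/andP; split; lra).
have : ((1 - a)%:E * legendre Phi ((1 - a)^-1 *: w) / legendre Phi w <= (1 + e)%:E)%E.
  by apply: le_trans h; apply: ereal_sup_ubound; exists w.
rewrite !legendreRE -EFinM.
have a'0 : 0 < 1 - a by lra.
have [->|f0] := eqVneq (legendreR w) 0.
  rewrite inver eqxx mulr0.
  have [->|p0] := eqVneq ((1 - a) * legendreR ((1 - a)^-1 *: w)) 0; first by [].
  have pp : (0 < ((1 - a) * legendreR ((1 - a)^-1 *: w))%:E)%E.
    by rewrite lte_fin lt_neqAle eq_sym p0 mulr_ge0 ?legendreR_ge0// ltW.
  by rewrite gt0_muley// leye_eq.
have fp : 0 < legendreR w by rewrite lt_neqAle eq_sym f0 legendreR_ge0.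
by rewrite inver (negbTE f0) -EFinM lee_fin ler_pdivrMr.
Qed.

End potential.

(** * Measurability and integrability *)

Section integrability.
Context {R : realType}.
Notation leb := (@lebesgue_measure R).

Lemma measurable_expRN d (T : measurableType d) (f : T -> R) : measurable_fun setT f ->
  measurable_fun setT (fun x => (expR (- f x))%:E).
Proof.
move=> mf; apply/measurable_EFinP; apply: (measurableT_comp (@measurable_expR R)).
exact: measurableT_comp.
Qed.

(** The conjugate is a supremum of affine functions, so the composite is lower
    semicontinuous. *)
Lemma measurable_legendreR_comp n (Phi : 'rV[R]_n -> R) (G : 'rV[R]_n -> 'rV[R]_n) :
  (forall x, 0 <= Phi x) -> Phi 0 = 0 ->
  Phi x / enorm x @[x --> enorm_infty] --> +oo ->
  continuous G -> measurable_fun setT (fun z => legendreR Phi (G z)).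
Proof.
move=> Phi_ge0 Phi0 Phi_superlinear cG.
apply: (measurability _ (RGenOInfty.measurableE R)).
move=> _ [_ [a ->] <-]; rewrite setTI; apply: open_measurable_rV.
have -> : (fun z => legendreR Phi (G z)) @^-1` `]a, +oo[ =
    \bigcup_(w in setT) [set z | a < dot (G z) w - Phi w].
  apply/seteqP; split => z /=; rewrite in_itv/= andbT.
    move=> h; apply: contrapT => h'; move: h; apply/negP; rewrite -leNgt.
    apply: legendreR_le => // w; rewrite leNgt; apply/negP => aw; apply: h'.
    by exists w.
  by move=> [w _ /= h]; apply: lt_le_trans h _; exact: legendreR_ub.
apply: bigcup_open => w _.
have cdot : continuous (fun z => dot (G z) w).
  rewrite /dot; apply: continuous_big => [|i _ z]; first exact: add_continuous.
  have cc : {for z, continuous (fun z => G z ord0 i)}.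
    exact: continuous_comp (cG z) (@coord_continuous _ _ _ ord0 i _).
  exact: cvgM cc (cvg_cst _).
have cd : continuous (fun z => dot (G z) w - Phi w).
  by move=> z; exact: cvgB (cdot z) (cvg_cst _).
rewrite (_ : mkset _ = (fun z => dot (G z) w - Phi w) @^-1` `]a, +oo[%classic).
  by move/continuousP: cd; apply; exact: interval_open.
by apply/seteqP; split => z /=; rewrite in_itv/= andbT.
Qed.

(** The function is dominated by the sum of the density of the exponential
    law and of its mirror image. *)
Lemma integral_exp_abs_lty : (\int[leb]_t (expR (- `|t|))%:E < +oo)%E.
Proof.
pose p : R -> R := exponential_pdf 1.
have mp : measurable_fun setT p by exact: measurable_exponential_pdf.
have p0 t : 0 <= p t by exact: exponential_pdf_ge0.
have I1 : (\int[leb]_t (p t)%:E = 1)%E by exact: integral_exponential_pdf.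
have mN : measurable_fun setT (fun t : R => p (- t)) by exact: measurableT_comp.
have I2 : (\int[leb]_t (p (- t))%:E = 1)%E.
  pose opp : measurableTypeR R -> measurableTypeR R := -%R.
  have mopp : measurable_fun setT opp by exact: oppr_measurable.
  have h := ge0_integral_pushforward mopp leb measurableT
    (proj2 (measurable_EFinP setT p) mp) (fun t _ => p0 t).
  rewrite -I1 -[LHS]h; apply: eq_measure_integral => A mA _.
  exact: lebesgue_measureN.
apply: (@le_lt_trans _ _ (\int[leb]_t ((p t)%:E + (p (- t))%:E))%E).
  apply: ge0_le_integral => //.
  - exact: (measurable_expRN (@normr_measurable R setT)).
  - by apply: emeasurable_funD; exact/measurable_EFinP.
  move=> t _; rewrite -EFinD lee_fin; have [t0|t0] := leP 0 t.
    rewrite ger0_norm//; have -> : p t = expR (- t) by rewrite /p exponential_pdfE// mul1r mulN1r.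
    by rewrite lerDl.
  rewrite ltr0_norm//; have -> : p (- t) = expR (- - t).
    by rewrite /p exponential_pdfE ?oppr_ge0 ?ltW// mul1r mulN1r.
  by rewrite lerDr.
rewrite ge0_integralD//; try exact/measurable_EFinP; try by move=> t _; rewrite lee_fin.
by rewrite I1 I2 -EFinD ltry.
Qed.

Lemma integral_exp_sum_lty n :
  (\int[@lebesgue_rV R n]_x (expR (- \sum_(i < n) `|x ord0 i|)%R)%:E < +oo)%E.
Proof.
have mS m : measurable_fun setT (fun x : 'rV[R]_m => (expR (- \sum_(i < m) `|x ord0 i|)%R)%:E).
  apply: measurable_expRN.
  apply: measurable_sum => i; apply: measurableT_comp => //; exact: measurable_coord_rV.
elim: n => [|n IH].
  rewrite [X in (X < _)%E]integral_dirac//=; last exact: mS.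
  by rewrite diracT mul1e ltry.
have pos (x : 'rV[R]_n.+1) :
    (0 <= (expR (- \sum_(i < n.+1) `|x ord0 i|)%R)%:E)%E by rewrite lee_fin expR_ge0.
rewrite [X in (X < _)%E](integral_rV_cons (mS n.+1) pos).
set C := (\int[@lebesgue_rV R n]_x _)%E in IH.
have C0 : (0 <= C)%E by apply: integral_ge0 => t _; rewrite lee_fin expR_ge0.
rewrite [X in (X < _)%E](_ : _ = \int[leb]_t ((expR (- `|t|))%:E * C))%E; last first.
  apply: eq_integral => t _; rewrite /C -ge0_integralZl//.
    apply: eq_integral => v _; rewrite -EFinM -expRD -opprD big_ord_recl rV_cons0.
    by under eq_bigr do rewrite rV_consS.
  exact: mS.
rewrite ge0_integralZr//; last exact: (measurable_expRN (@normr_measurable R setT)).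
have I0 : (0 <= \int[leb]_t (expR (- `|t|))%:E)%E.
  by apply: integral_ge0 => t _; rewrite lee_fin expR_ge0.
by rewrite lte_mul_pinfty// ge0_fin_numE// integral_exp_abs_lty.
Qed.

Lemma superlinear_exp_integrable n (Phi : 'rV[R]_n -> R) (s : R) : 0 < s ->
  (forall x, 0 <= Phi x) -> continuous Phi ->
  Phi x / enorm x @[x --> enorm_infty] --> +oo ->
  (lebesgue_rV n).-integrable setT (fun x => (expR (- (s * Phi x)))%:E).
Proof.
move=> s0 Phi_ge0 cPhi Phi_superlinear.
have c0 : 0 <= n%:R / s by rewrite divr_ge0// ltW.
have [m m0 hm] := superlinear_growth Phi_ge0 Phi_superlinear c0.
have mf : measurable_fun setT (fun x => (expR (- (s * Phi x)))%:E).
  apply: measurable_expRN.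
  by apply: measurable_funM => //; exact: continuous_measurable_rV.
have mS : measurable_fun setT (fun x : 'rV[R]_n => (expR (- \sum_(i < n) `|x ord0 i|)%R)%:E).
  apply: measurable_expRN.
  apply: measurable_sum => i; apply: measurableT_comp => //; exact: measurable_coord_rV.
apply/integrableP; split => //.
apply: (@le_lt_trans _ _ (\int[@lebesgue_rV R n]_x
   ((expR (s * m))%:E * (expR (- \sum_(i < n) `|x ord0 i|)%R)%:E))%E).
  apply: ge0_le_integral => //.
  - exact: measurableT_comp.
  - exact: emeasurable_funM.
  move=> x _; rewrite -EFinM abse_EFin lee_fin ger0_norm ?expR_ge0// -expRD ler_expR.
  have := hm x; rewrite -(ler_pM2l s0) mulrDr => h.
  have : \sum_(i < n) `|x ord0 i| <= s * (n%:R / s * enorm x); last by lra.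
  rewrite mulrA [s * _]mulrC divfK; last by rewrite gt_eqF.
  rewrite -[n in n%:R]card_ord -sum1_card natr_sum mulr_suml.
  by apply: ler_sum => i _; rewrite mul1r coord_le_enorm.
rewrite ge0_integralZl// ?lee_fin ?expR_ge0//.
by rewrite lte_mul_pinfty ?integral_exp_sum_lty// lee_fin expR_ge0.
Qed.

Lemma cvg_box_Rintegral n (f : 'rV[R]_n -> R) :
  (lebesgue_rV n).-integrable setT (EFin \o f) ->
  \int[@lebesgue_rV R n]_(x in box k.+1%:R) f x @[k --> \oo] -->
  \int[@lebesgue_rV R n]_x f x.
Proof.
move=> fi.
have mf := measurable_int _ fi.
have := @dominated_convergence _ _ R (lebesgue_rV n) setT measurableT
   (fun k x => (f \_ (box k.+1%:R) x)%:E) (EFin \o f) (fun x => `|(f x)%:E|)%E.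
case=> //.
- move=> k; apply/measurable_EFinP/(measurable_restrictT _ (@measurable_box R n k.+1%:R)).
  by apply: measurable_funTS; exact/measurable_EFinP.
- apply: aeW => x _; apply: cvg_near_cst; exists (Num.truncn (enorm x)) => // k /= xk.
  rewrite patchE mem_set// => i; apply: le_trans (coord_le_enorm x i) _.
  by rewrite ltW// (lt_le_trans (truncnS_gt _))// ler_nat ltnS.
- exact: integrable_abse.
- apply: aeW => x k _; rewrite patchE; case: ifPn => // _.
  by rewrite /= normr0 lee_fin.
move=> _ _ h.
have fin : (\int[lebesgue_rV n]_x (f x)%:E)%E \is a fin_num.
  exact: integrable_fin_num.
move: h; rewrite -[X in _ --> X](fineK fin) => /fine_cvg.
apply: cvg_trans.
by under eq_fun do rewrite Rintegral_mkcond.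
Qed.

End integrability.

(** * Integration against the Gibbs measure *)

Section gibbs_density.
Context {R : realType} {n : nat} (Phi : 'rV[R]_n -> R) (cPhi : continuous Phi).

HB.instance Definition _ := isMeasure.Build _ _ _ (gibbs Phi)
  (gibbs0 Phi) (gibbs_ge0 Phi) (gibbs_sigma_additive cPhi).

(** The Gibbs set function with its measure structure, which the integration
    lemmas need. *)
Definition gibbs_measure : {measure set 'rV[R]_n -> \bar R} := gibbs Phi.

Let mu := gibbs_measure.

Local Open Scope ereal_scope.

Context (z : R) (Zz : gibbs_Z Phi = z%:E) (z0 : (0 < z)%R).

Let D (x : 'rV[R]_n) : \bar R := (expR (- Phi x) / z)%:E.

Let D0 x : 0 <= D x.
Proof. by rewrite lee_fin divr_ge0 ?expR_ge0// ltW. Qed.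

Let mD : measurable_fun setT D.
Proof.
apply/measurable_EFinP; apply: measurable_funM => //.
by have /measurable_EFinP := measurable_expRN (continuous_measurable_rV cPhi).
Qed.

Let gibbsE A : gibbs Phi A = \int[lebesgue_rV n]_(x in A) D x.
Proof. by apply: eq_integral => x _; rewrite Zz inver gt_eqF. Qed.

Import HBNNSimple.

(** By monotone approximation with simple functions, from the case of
    indicators, which is the definition of the Gibbs measure. *)
Lemma ge0_integral_gibbs (f : 'rV[R]_n -> \bar R) :
  measurable_fun setT f -> (forall x, 0 <= f x) ->
  \int[gibbs Phi]_x f x = \int[lebesgue_rV n]_x (f x * D x).
Proof.
move=> mf f0; pose f_ := nnsfun_approx measurableT mf.
have nd x m k : (m <= k)%N -> (f_ m x <= f_ k x)%R.
  by move=> mk; exact/lefP/nd_nnsfun_approx.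
transitivity (limn (fun k => \int[mu]_x (f_ k x)%:E)).
  rewrite -monotone_convergence//.
  - by apply: eq_integral => x _; apply/esym/cvg_lim => //; exact: cvg_nnsfun_approx.
  - by move=> k; exact/measurable_EFinP.
  - by move=> k x _; rewrite lee_fin.
  - by move=> x _ m k mk; rewrite lee_fin; exact: nd.
transitivity (limn (fun k => \int[lebesgue_rV n]_x ((f_ k x)%:E * D x))); last first.
  rewrite -monotone_convergence//.
  - apply: eq_integral => x _; apply/cvg_lim => //.
    have h := @cvg_nnsfun_approx _ _ _ _ measurableT _ mf (fun x _ => f0 x) x I.
    exact: cvgeZr h.
  - by move=> k; apply: emeasurable_funM => //; exact/measurable_EFinP.
  - by move=> k x _; rewrite mule_ge0// lee_fin.
  - by move=> x _ m k mk; rewrite lee_wpmul2r// lee_fin; exact: nd.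
congr (limn _); apply/funext => k.
transitivity (\sum_(r \in range (f_ k)) \int[mu]_x (r * \1_(f_ k @^-1` [set r]) x)%:E).
  under eq_integral do rewrite fimfunE -fsumEFin//.
  rewrite ge0_integral_fsum//.
  - by move=> r; exact/measurable_EFinP/measurable_funM.
  - by move=> r x _; rewrite nnfun_muleindic_ge0.
transitivity (\sum_(r \in range (f_ k))
    \int[lebesgue_rV n]_x ((r * \1_(f_ k @^-1` [set r]) x)%:E * D x)); last first.
  rewrite -ge0_integral_fsum//.
  - apply: eq_integral => x _; rewrite [in RHS]fimfunE -fsumEFin//.
    rewrite ge0_mule_fsuml// => r; exact: nnfun_muleindic_ge0.
  - move=> r; apply: emeasurable_funM => //.
    by exact/measurable_EFinP/measurable_funM.
  - by move=> r x _; rewrite mule_ge0// nnfun_muleindic_ge0.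
apply: eq_fsbigr => r; rewrite inE => -[y _ ry].
have r0 : (0 <= r)%R by rewrite -ry.
have mr : measurable (f_ k @^-1` [set r]) by exact: measurable_sfunP.
under eq_integral do rewrite EFinM.
rewrite ge0_integralZl//; last exact/measurable_EFinP.
rewrite integral_indic// setIT /= gibbsE.
under [RHS]eq_integral do rewrite EFinM -muleA.
rewrite [RHS]ge0_integralZl//.
- congr (_ * _); rewrite [LHS]integral_mkcond; apply: eq_integral => x _.
  by rewrite patchE indicE; case: ifPn => _; rewrite ?mul1e ?mul0e.
- by apply: emeasurable_funM => //; exact/measurable_EFinP.
- by move=> x _; rewrite mule_ge0// lee_fin.
Qed.

End gibbs_density.

Section gibbs_real_integrals.
Context {R : realType} {n : nat} (Phi : 'rV[R]_n -> R) (cPhi : continuous Phi)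
  (z : R) (Zz : gibbs_Z Phi = z%:E) (z0 : 0 < z).
Notation leb := (@lebesgue_rV R n).
Implicit Type f : 'rV[R]_n -> R.

Let mexp : measurable_fun setT (fun x => expR (- Phi x)).
Proof.
by have /measurable_EFinP := measurable_expRN (continuous_measurable_rV cPhi).
Qed.

Lemma ge0_gibbs_integral f : measurable_fun setT f -> (forall x, 0 <= f x) ->
  (z%:E * \int[gibbs Phi]_x (f x)%:E = \int[leb]_x (expR (- Phi x) * f x)%:E)%E.
Proof.
move=> mf f0; rewrite (ge0_integral_gibbs cPhi Zz z0)//; last exact/measurable_EFinP.
rewrite -ge0_integralZl//.
- apply: eq_integral => x _; rewrite -!EFinM; congr EFin.
  by field; rewrite gt_eqF.
- apply/measurable_EFinP; apply: measurable_funM => //; exact: measurable_funM.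
- by move=> x _; rewrite mule_ge0// lee_fin// divr_ge0 ?expR_ge0// ltW.
- by rewrite lee_fin ltW.
Qed.

Lemma gibbs_integrable f : (gibbs Phi).-integrable setT (EFin \o f) ->
  leb.-integrable setT (EFin \o (fun x => expR (- Phi x) * f x)).
Proof.
move=> /integrableP[/measurable_EFinP mf fi]; apply/integrableP; split.
  by apply/measurable_EFinP; exact: measurable_funM.
have -> : (\int[leb]_x `|(expR (- Phi x) * f x)%:E| =
    z%:E * \int[gibbs Phi]_x (`|f x|)%:E)%E.
  rewrite ge0_gibbs_integral//; last exact: measurableT_comp.
  by apply: eq_integral => x _; rewrite /= normrM ger0_norm ?expR_ge0.
rewrite lte_mul_pinfty//; last by rewrite lee_fin ltW.
Qed.

Lemma gibbs_integral f : (gibbs Phi).-integrable setT (EFin \o f) ->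
  (z%:E * \int[gibbs Phi]_x (f x)%:E = \int[leb]_x (expR (- Phi x) * f x)%:E)%E.
Proof.
move=> fi; have lfi := gibbs_integrable fi.
have /integrableP[/measurable_EFinP mf _] := fi.
pose fp x : R := Num.max (f x) 0; pose fn x : R := Num.max (- f x) 0.
have fp0 x : 0 <= fp x by rewrite le_max lexx orbT.
have fn0 x : 0 <= fn x by rewrite le_max lexx orbT.
have mp : measurable_fun setT fp by exact: measurable_funrpos.
have mn : measurable_fun setT fn by exact: measurable_funrneg.
have pE : (\int[leb]_x ((EFin \o (fun x => expR (- Phi x) * f x)%R)^\+ x) =
    z%:E * \int[gibbs Phi]_x (fp x)%:E)%E.
  rewrite ge0_gibbs_integral//; apply: eq_integral => x _.
  by rewrite funeposE /= -EFin_max /fp maxr_pMr ?expR_ge0// mulr0.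
have nE : (\int[leb]_x ((EFin \o (fun x => expR (- Phi x) * f x)%R)^\- x) =
    z%:E * \int[gibbs Phi]_x (fn x)%:E)%E.
  rewrite ge0_gibbs_integral//; apply: eq_integral => x _.
  by rewrite funenegE /= -EFin_max /fn maxr_pMr ?expR_ge0// mulr0 mulrN.
have finP : (\int[gibbs Phi]_x (fp x)%:E)%E \is a fin_num.
  have : (0 <= \int[gibbs Phi]_x (fp x)%:E)%E.
    by apply: (@integral_ge0 _ _ _ (gibbs_measure cPhi)) => x _; rewrite lee_fin.
  have := integral_funepos_lt_pinfty measurableT lfi; rewrite pE.
  by case: (\int[gibbs Phi]_x _)%E => //; rewrite gt0_muley// lte_fin.
rewrite integralE [RHS]integralE pE nE.
have -> : (\int[gibbs Phi]_x (EFin \o f)^\+ x = \int[gibbs Phi]_x (fp x)%:E)%E.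
  by apply: (@eq_integral _ _ _ (gibbs_measure cPhi)) => x _; rewrite funeposE /= -EFin_max.
have -> : (\int[gibbs Phi]_x (EFin \o f)^\- x = \int[gibbs Phi]_x (fn x)%:E)%E.
  by apply: (@eq_integral _ _ _ (gibbs_measure cPhi)) => x _; rewrite funenegE /= -EFin_max.
by rewrite muleBr// fin_num_adde_defr.
Qed.

End gibbs_real_integrals.

(** * The inequality with respect to Lebesgue measure *)

Section lebesgue_inequality.
Context {R : realType} {n : nat} (Phi : 'rV[R]_n -> R).
Context (Phi_C1 : continuously_differentiable Phi) (Phi_convex : strictly_convex Phi)
  (Phi_even : forall x, Phi (- x) = Phi x)
  (Phi_superlinear : Phi x / enorm x @[x --> enorm_infty] --> +oo)
  (Phi_ge0 : forall x, 0 <= Phi x) (Phi0 : Phi 0 = 0).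
Notation leb := (@lebesgue_rV R n).
Notation L := (legendreR Phi).

Lemma C1_continuous f : @continuously_differentiable R n f -> continuous f.
Proof. by move=> [df _] x; exact: differentiable_continuous. Qed.

Lemma continuous_box_bounded_vec (G : 'rV[R]_n -> 'rV[R]_n) (r : R) : continuous G ->
  exists2 s, 0 <= s & forall x, box r x -> box s (G x).
Proof.
move=> cG.
have /choice[B hB] i : exists B, forall x, box r x -> `|G x ord0 i| <= B.
  apply: (@continuous_box_bounded _ _ (fun x => G x ord0 i)) => x.
  exact: continuous_comp (cG x) (@coord_continuous _ _ _ ord0 i _).
exists (\sum_(i < n) `|B i|); first by apply: sumr_ge0.
move=> x xr i; apply: (le_trans (hB i x xr)); apply: (le_trans (ler_norm _)).
by rewrite (bigD1 i)//= lerDl sumr_ge0.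
Qed.

Lemma le_box_Rintegral (f : 'rV[R]_n -> R) r : (forall x, 0 <= f x) ->
  leb.-integrable setT (EFin \o f) ->
  \int[leb]_(x in box r) f x <= \int[leb]_x f x.
Proof.
move=> f0 fi; have mf := measurable_int _ fi; rewrite Rintegral_mkcond; apply: le_Rintegral => //.
  apply: le_integrable fi => //.
    apply/measurable_EFinP/(measurable_restrictT _ (@measurable_box R n r)).
    by apply: measurable_funTS; exact/measurable_EFinP.
  by move=> x _; rewrite /= patchE; case: ifPn => // _; rewrite normr0 lee_fin.
by move=> x _; rewrite patchE; case: ifPn.
Qed.

(** The first-order inequality on a cube, with V = Phi and
    K = - Phi + (a + e A) Phi + 2 Phi^* (grad g / a); the terms - Phi of h and of
    K cancel. *)
Lemma box_entropy_le_legendre (g : 'rV[R]_n -> R) (a e A r : R) : 0 < r ->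
  continuously_differentiable g ->
  0 < a < 1 -> 0 <= e ->
  (forall w, (1 - a) * L ((1 - a)^-1 *: w) <= (1 + e) * L w) ->
  (forall x, dot x (gradient Phi x) <= (A + 1) * Phi x) ->
  forall M c, M = \int[leb]_(x in box r) expR (g x - Phi x) ->
  c = \int[leb]_(x in box r) expR (- Phi x) ->
  \int[leb]_(x in box r) (expR (g x - Phi x) * g x) + M * ln (c / M) <=
  (a + e * A) * \int[leb]_(x in box r) (expR (g x - Phi x) * Phi x) +
  2 * \int[leb]_(x in box r) (expR (g x - Phi x) * L (a^-1 *: gradient g x)).
Proof.
move=> r0 C1g a01 e0 ha hA M c ME cE.
have cg := C1_continuous C1g; have cP := C1_continuous Phi_C1.
have mg := continuous_measurable_rV cg; have mP := continuous_measurable_rV cP.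
have [Bg hBg] := continuous_box_bounded r cg.
have [BP hBP] := continuous_box_bounded r cP.
pose Lg x := L (a^-1 *: gradient g x).
have cGg : continuous (fun x => a^-1 *: gradient g x).
  have [_ cgr] := C1g.
  by move=> x; exact: (continuousZl_tmp (k := a^-1) (cgr x)).
have mL : measurable_fun setT Lg by exact: measurable_legendreR_comp.
have L0 x : 0 <= Lg x by exact: legendreR_ge0.
have [s s0 hs] := continuous_box_bounded_vec r cGg.
have [BL hBL] := legendre_box_bounded Phi_ge0 Phi_superlinear s0.
have LB x : box r x -> Lg x <= BL.
  by move=> /hs /hBL; rewrite legendreRE// lee_fin.
have zr : box r (0 : 'rV[R]_n) by move=> i; rewrite mxE normr0 ltW.
have Bg0 : 0 <= Bg by apply: le_trans (hBg 0 zr).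
have BP0 : 0 <= BP by apply: le_trans (hBP 0 zr).
have BL0 : 0 <= BL by apply: le_trans (LB 0 zr).
pose t := a + e * A.
pose K x := - Phi x + t * Phi x + 2 * Lg x.
pose h x := g x - Phi x.
pose B := Bg + BP + `|t| * BP + 2 * BL.
have tB : 0 <= `|t| * BP by rewrite mulr_ge0.
have hB x : box r x -> `|h x| <= B.
  move=> xr; apply: (le_trans (ler_normB _ _)).
  by have := hBg x xr; have := hBP x xr; rewrite /B; lra.
have VB x : box r x -> `|Phi x| <= B.
  by move=> xr; have := hBP x xr; rewrite /B; lra.
have KB x : box r x -> `|K x| <= B.
  move=> xr; rewrite /K /B; apply: (le_trans (ler_normD _ _)).
  have h1 : `|2 * Lg x| <= 2 * BL.
    by rewrite normrM !ger0_norm// ler_pM2l// LB.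
  have h2 : `|- Phi x + t * Phi x| <= BP + `|t| * BP.
    apply: (le_trans (ler_normD _ _)); rewrite normrN normrM lerD ?hBP//.
    by rewrite ler_wpM2l ?hBP.
  lra.
have mh : measurable_fun setT h by exact: measurable_funB.
have mK : measurable_fun setT K.
  apply: measurable_funD; last by apply: measurable_funM => //.
  apply: measurable_funD; first exact: measurableT_comp.
  exact: measurable_funM.
have := @box_entropy_le_tangent R n r B M c h Phi K (fun x => gradient g x - gradient Phi x) r0
  mh mP mK hB VB KB.
have Bi (f : 'rV[R]_n -> R) (C : R) : measurable_fun setT f ->
    (forall x, box r x -> `|f x| <= C) ->
    leb.-integrable (box r) (EFin \o (fun x => expR (h x) * f x)).
  move=> mf fC; apply: (@box_integrable _ _ _ (expR B * C)).
    by apply: measurable_funM => //; exact: measurableT_comp.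
  move=> x xr; rewrite normrM ger0_norm ?expR_ge0//.
  apply: ler_pM; rewrite ?expR_ge0 ?fC// ler_expR.
  by have := hB x xr; rewrite ler_norml => /andP[].
have ig := Bi g Bg mg hBg; have iP := Bi Phi BP mP hBP.
have iL : leb.-integrable (box r) (EFin \o (fun x => expR (h x) * Lg x)).
  by apply: (Bi Lg BL) => // x xr; rewrite ger0_norm ?LB.
have mb := @measurable_box R n r.
have E1 : \int[leb]_(x in box r) (expR (h x) * h x) =
   \int[leb]_(x in box r) (expR (h x) * g x) - \int[leb]_(x in box r) (expR (h x) * Phi x).
  rewrite -RintegralB//; apply: eq_Rintegral => x _; rewrite {2}/h; ring.
have itP : leb.-integrable (box r) (EFin \o (fun x => t * (expR (h x) * Phi x))).
  by apply: eq_integrable (integrableZl mb t iP).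
have i2L : leb.-integrable (box r) (EFin \o (fun x => 2 * (expR (h x) * Lg x))).
  by apply: eq_integrable (integrableZl mb 2 iL).
have isum : leb.-integrable (box r)
    (EFin \o (fun x => t * (expR (h x) * Phi x) + 2 * (expR (h x) * Lg x))).
  by apply: eq_integrable (integrableD mb itP i2L).
have E2 : \int[leb]_(x in box r) (expR (h x) * K x) =
   t * \int[leb]_(x in box r) (expR (h x) * Phi x) +
   2 * \int[leb]_(x in box r) (expR (h x) * Lg x) -
   \int[leb]_(x in box r) (expR (h x) * Phi x).
  rewrite -!RintegralZl// -RintegralD// -RintegralB//.
  by apply: eq_Rintegral => x _; rewrite /K; ring.
rewrite E1 E2 => H.
suff : \int[leb]_(x in box r) (expR (h x) * g x) - \int[leb]_(x in box r) (expR (h x) * Phi x)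
    + M * ln (c / M) <=
   t * \int[leb]_(x in box r) (expR (h x) * Phi x) +
   2 * \int[leb]_(x in box r) (expR (h x) * Lg x) -
   \int[leb]_(x in box r) (expR (h x) * Phi x).
  by rewrite /t /h /Lg; lra.
apply: H => //.
- move=> eps eps0; have eps2 : 0 < eps / 2 by rewrite divr_gt0.
  have [d1 d10 hd1] := C1_uniform_expansion C1g r0 eps2.
  have [d2 d20 hd2] := C1_uniform_expansion Phi_C1 r0 eps2.
  exists (Num.min d1 d2); first by rewrite lt_min d10.
  move=> b x y z /andP[b0]; rewrite lt_min => /andP[bd1 bd2] xr yr zE.
  have := hd1 b x y z; rewrite b0 bd1 => /(_ isT xr yr zE).
  have := hd2 b x y z; rewrite b0 bd2 => /(_ isT xr yr zE).
  rewrite /h dotBl !ler_norml => /andP[? ?] /andP[? ?]; lra.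
- by move=> z y _ _; rewrite /K /t /Lg; apply: tangent_le_legendreR.
Qed.

(** The passage to the whole space, and the absorption of the term in Phi: E is
    the entropy and I the energy with respect to the Gibbs measure, Z the
    normalizing constant, and Z-multiples of them are Lebesgue integrals. *)
Lemma entropy_le_legendre_lebesgue (g : 'rV[R]_n -> R) (a e A Z Y E I : R) :
  continuously_differentiable g ->
  0 < a < 1 -> 0 <= e -> 0 <= A ->
  (forall w, (1 - a) * L ((1 - a)^-1 *: w) <= (1 + e) * L w) ->
  (forall x, dot x (gradient Phi x) <= (A + 1) * Phi x) ->
  leb.-integrable setT (EFin \o (fun x => expR (g x - Phi x))) ->
  leb.-integrable setT (EFin \o (fun x => expR (g x - Phi x) * g x)) ->
  leb.-integrable setT (EFin \o (fun x => expR (g x - Phi x) * L (a^-1 *: gradient g x))) ->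
  0 < Z ->
  Z = \int[leb]_x expR (- Phi x) ->
  Z = \int[leb]_x expR (g x - Phi x) ->
  Y = \int[leb]_x expR (- (2^-1 * Phi x)) ->
  Z * E = \int[leb]_x (expR (g x - Phi x) * g x) ->
  Z * I = \int[leb]_x (expR (g x - Phi x) * L (a^-1 *: gradient g x)) ->
  4 * (a + e * A) * Y <= Z -> 1 <= E -> E <= 4 * I.
Proof.
move=> C1g a01 e0 A0 ha hA ih ihg ihL Z0 ZE ZhE YE EE IE small E1.
have cg := C1_continuous C1g; have cP := C1_continuous Phi_C1.
have mg := continuous_measurable_rV cg; have mP := continuous_measurable_rV cP.
have iPs s : 0 < s -> leb.-integrable setT (EFin \o (fun x => expR (- (s * Phi x)))).
  by move=> s0; exact: superlinear_exp_integrable.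
have iP : leb.-integrable setT (EFin \o (fun x => expR (- Phi x))).
  by have := iPs 1 ltr01; under eq_fun do rewrite mul1r.
have iP2 : leb.-integrable setT (EFin \o (fun x => expR (- (2^-1 * Phi x)))).
  by apply: iPs; rewrite invr_gt0.
(* Young's inequality, multiplied by e^(- Phi) *)
have young x : expR (g x - Phi x) * Phi x <=
    2 * (expR (g x - Phi x) * g x - expR (g x - Phi x) + expR (- (2^-1 * Phi x))).
  have -> : - (2^-1 * Phi x) = (g x - Phi x) + (2^-1 * Phi x - g x) by field.
  rewrite [expR (g x - Phi x + _)]expRD; set u := expR (g x - Phi x).
  have u0 : 0 <= u by exact: expR_ge0.
  have : u * (1 + (2^-1 * Phi x - g x)) <= u * expR (2^-1 * Phi x - g x).
    by rewrite ler_wpM2l ?expR_ge1Dx.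
  lra.
have mT := @measurableT _ 'rV[R]_n.
have i1 : leb.-integrable setT
   (EFin \o (fun x => expR (g x - Phi x) * g x - expR (g x - Phi x))).
  by apply: eq_integrable (integrableB mT ihg ih).
have i2 : leb.-integrable setT
   (EFin \o (fun x => expR (g x - Phi x) * g x - expR (g x - Phi x) + expR (- (2^-1 * Phi x)))).
  by apply: eq_integrable (integrableD mT i1 iP2).
have i3 : leb.-integrable setT
   (EFin \o (fun x => 2 * (expR (g x - Phi x) * g x - expR (g x - Phi x) + expR (- (2^-1 * Phi x))))).
  by apply: eq_integrable (integrableZl mT 2 i2).
have ihP : leb.-integrable setT (EFin \o (fun x => expR (g x - Phi x) * Phi x)).
  apply: le_integrable i3 => //.
    apply/measurable_EFinP; apply: measurable_funM => //.
    by apply: (measurableT_comp (@measurable_expR R)); exact: measurable_funB.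
  move=> x _; rewrite /= lee_fin ger0_norm ?mulr_ge0 ?expR_ge0//.
  exact: le_trans (young x) (ler_norm _).
have hP : \int[leb]_x (expR (g x - Phi x) * Phi x) <= 2 * (Z * E - Z + Y).
  rewrite EE ZhE YE -RintegralB// -RintegralD// -RintegralZl//.
  exact: le_Rintegral.
have ZY : Z <= Y.
  rewrite ZE YE; apply: le_Rintegral => // x _; rewrite ler_expR.
  by have := Phi_ge0 x; lra.
set t := a + e * A in small.
have t0 : 0 <= t by rewrite addr_ge0 ?mulr_ge0//; case/andP: a01 => /ltW.
have L0 x : 0 <= L x by exact: legendreR_ge0.
pose Mk k := \int[leb]_(x in box k.+1%:R) expR (g x - Phi x).
pose ck k := \int[leb]_(x in box k.+1%:R) expR (- Phi x).
pose uk k := \int[leb]_(x in box k.+1%:R) (expR (g x - Phi x) * g x).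
have bound k : uk k + Mk k * ln (ck k / Mk k) <=
    t * (2 * (Z * E - Z + Y)) + 2 * (Z * I).
  apply: (le_trans (@box_entropy_le_legendre g a e A k.+1%:R _ C1g a01 e0 ha hA (Mk k) (ck k) erefl erefl)) => //.
  rewrite IE; apply: lerD.
    rewrite ler_wpM2l//; apply: le_trans hP; apply: le_box_Rintegral => // x.
    by rewrite mulr_ge0 ?expR_ge0.
  rewrite ler_pM2l//; apply: le_box_Rintegral => // x.
  by rewrite mulr_ge0 ?expR_ge0.
have cM : Mk k @[k --> \oo] --> Z by rewrite ZhE; exact: cvg_box_Rintegral.
have cc : ck k @[k --> \oo] --> Z by rewrite ZE; exact: cvg_box_Rintegral.
have cu : uk k @[k --> \oo] --> Z * E by rewrite EE; exact: cvg_box_Rintegral.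
have cq : ck k / Mk k @[k --> \oo] --> (1 : R).
  rewrite -(@divff _ Z) ?gt_eqF//; apply: cvgM => //.
  by apply: cvgV => //; rewrite gt_eqF.
have cl : ln (ck k / Mk k) @[k --> \oo] --> (0 : R).
  by rewrite -ln1; apply: continuous_cvg cq; exact: continuous_ln.
have cv : uk k + Mk k * ln (ck k / Mk k) @[k --> \oo] --> Z * E + Z * 0.
  by apply: cvgD => //; exact: cvgM.
have : Z * E + Z * 0 <= t * (2 * (Z * E - Z + Y)) + 2 * (Z * I).
  by apply: (cvgr_to_le cv); exists 0%N.
(* This is where the entropy being at least 1 is used. *)
have h1 : Z * E - Z + Y <= Y * E.
  have : 0 <= (Y - Z) * (E - 1) by rewrite mulr_ge0//; lra.
  lra.
have h2 : t * (2 * (Z * E - Z + Y)) <= t * (2 * (Y * E)).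
  by rewrite ler_wpM2l// ler_pM2l.
have h3 : 4 * t * Y * E <= Z * E by rewrite ler_pM2r//; lra.
move=> h4.
have : Z * E <= Z * (4 * I) by lra.
by rewrite ler_pM2l.
Qed.

End lebesgue_inequality.

(** * The modified logarithmic Sobolev inequality *)

Theorem theorem4p1 (R : realType) (n : nat) (Phi : 'rV[R]_n -> R)
  (Phi_C1 : continuously_differentiable Phi)
  (Phi_strictly_convex : strictly_convex Phi)
  (Phi_even : forall x : 'rV[R]_n, Phi (- x) = Phi x)
  (Phi_superlinear : Phi x / enorm x @[x --> enorm_infty] --> +oo)
  (Phi_ge0 : forall x, 0 <= Phi x)
  (Phi0 : Phi 0 = 0)
  (Phi_limit :
    ereal_sup [set ((1 - alpha)%:E *
                      legendre Phi ((1 - alpha)^-1 *: x) / legendre Phi x)%E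
              | x in [set x : 'rV[R]_n | x != 0]]
      @[alpha --> within `[0, 1] (nbhs (0 : R))] --> 1%:E)
  (Phi_growth : exists2 A : R, 0 < A &
    forall x, dot x (gradient Phi x) <= (A + 1) * Phi x) :
  exists C1 C2 : R, [/\ 0 <= C1, 0 <= C2 &
    forall g : 'rV[R]_n -> R, continuously_differentiable g ->
      (gibbs Phi).-integrable setT (fun x => (expR (g x))%:E) ->
      (gibbs Phi).-integrable setT
        (EFin \o entropy_integrand (gibbs Phi) (expR \o g)) ->
      (\int[gibbs Phi]_x (expR (g x))%:E = 1)%E ->
      (1 <= entropy (gibbs Phi) (expR \o g))%E ->
      (entropy (gibbs Phi) (expR \o g) <=
        C1%:E * \int[gibbs Phi]_x
          (legendre Phi (C2 *: gradient g x) * (expR (g x))%:E))%E].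
Proof.
have [A A0 hA] := Phi_growth.
have cPhi := C1_continuous Phi_C1.
have iPs s : 0 < s -> (lebesgue_rV n).-integrable setT
    (EFin \o (fun x : 'rV[R]_n => expR (- (s * Phi x)))).
  by move=> s0; exact: superlinear_exp_integrable.
have iP : (lebesgue_rV n).-integrable setT (EFin \o (fun x => expR (- Phi x))).
  by have := iPs 1 ltr01; under eq_fun do rewrite mul1r.
have iP2 : (lebesgue_rV n).-integrable setT (EFin \o (fun x => expR (- (2^-1 * Phi x)))).
  by apply: iPs; rewrite invr_gt0.
pose z := \int[lebesgue_rV n]_x expR (- Phi x).
pose Y := \int[lebesgue_rV n]_x expR (- (2^-1 * Phi x)).
have z0 : 0 < z.
  have mN : measurable_fun setT (fun x => - Phi x).
    by apply: measurableT_comp => //; exact: continuous_measurable_rV.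
  have [B hB] := continuous_box_bounded 1 cPhi.
  apply: lt_le_trans (@box_Rintegral_expR_gt0 R n 1 B _ ltr01 mN _) _.
    by move=> x /hB; rewrite normrN.
  by apply: le_box_Rintegral => // x; exact: expR_ge0.
have Y0 : 0 < Y.
  apply: lt_le_trans z0 _; apply: le_Rintegral => // x _; rewrite ler_expR.
  by have := Phi_ge0 x; lra.
have Zz : gibbs_Z Phi = z%:E.
  by rewrite /z fineK//; exact: integrable_fin_num.
(* th bounds a + e A; this value makes the term in Phi at most half the
   entropy. *)
pose th := z / (4 * Y).
have th0 : 0 < th by rewrite divr_gt0// mulr_gt0.
pose e := th / (2 * A).
have e0 : 0 < e by rewrite divr_gt0// mulr_gt0.
have th2 : 0 < th / 2 by rewrite divr_gt0.
have [a [a01 ath ha]] := legendreR_dilation Phi_ge0 Phi0 Phi_superlinear e0 th2 Phi_limit.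
have a0 : 0 < a by case/andP: a01.
exists 4, a^-1; split=> [//||g g_C1 ieg ient eg1 E1]; first by rewrite invr_ge0 ltW.
have cg := C1_continuous g_C1; have mg := continuous_measurable_rV cg.
have meg : measurable_fun setT (fun x => expR (g x)) by exact: measurableT_comp.
have entE : entropy_integrand (gibbs Phi) (expR \o g) = (fun x => expR (g x) * g x).
  by apply/funext => x; rewrite /entropy_integrand eg1 /= divr1 expRK.
rewrite entE in ient.
have mexpD x : expR (- Phi x) * expR (g x) = expR (g x - Phi x).
  by rewrite -expRD addrC.
have [_ cgr] := g_C1.
have mL : measurable_fun setT (fun x => legendreR Phi (a^-1 *: gradient g x)).
  apply: measurable_legendreR_comp => // x.
  exact: (continuousZl_tmp (k := a^-1) (cgr x)).
pose f3 x := legendreR Phi (a^-1 *: gradient g x) * expR (g x).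
have f30 x : 0 <= f3 x by rewrite mulr_ge0 ?expR_ge0// legendreR_ge0.
have mf3 : measurable_fun setT f3 by exact: measurable_funM.
have IE : (\int[gibbs Phi]_x (legendre Phi (a^-1 *: gradient g x) * (expR (g x))%:E) =
    \int[gibbs Phi]_x (f3 x)%:E)%E.
  by apply: (@eq_integral _ _ _ (gibbs_measure cPhi)) => x _; rewrite legendreRE.
rewrite IE; have [Ioo|Ifin] := eqVneq (\int[gibbs Phi]_x (f3 x)%:E)%E +oo%E.
  by rewrite Ioo gt0_muley ?leey.
have I0 : (0 <= \int[gibbs Phi]_x (f3 x)%:E)%E.
  by apply: (@integral_ge0 _ _ _ (gibbs_measure cPhi)) => x _; rewrite lee_fin.
have /fineK IK : (\int[gibbs Phi]_x (f3 x)%:E)%E \is a fin_num.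
  by rewrite ge0_fin_numE// lt_neqAle Ifin leey.
have /fineK EK : entropy (gibbs Phi) (expR \o g) \is a fin_num.
  rewrite /entropy entE; exact: (@integrable_fin_num _ _ _ (gibbs_measure cPhi)).
rewrite -EK -IK -EFinM lee_fin.
have i1 : (lebesgue_rV n).-integrable setT (EFin \o (fun x => expR (g x - Phi x))).
  have := gibbs_integrable cPhi Zz z0 ieg.
  by under eq_fun do rewrite mexpD.
have i2 : (lebesgue_rV n).-integrable setT (EFin \o (fun x => expR (g x - Phi x) * g x)).
  have := gibbs_integrable cPhi Zz z0 ient.
  by under eq_fun do rewrite mulrA mexpD.
have E3 x : expR (- Phi x) * f3 x = expR (g x - Phi x) * legendreR Phi (a^-1 *: gradient g x).
  by rewrite /f3 mulrCA mexpD mulrC.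
have i3 : (lebesgue_rV n).-integrable setT
    (EFin \o (fun x => expR (g x - Phi x) * legendreR Phi (a^-1 *: gradient g x))).
  have : (gibbs Phi).-integrable setT (EFin \o f3).
    apply/integrableP; split; first exact/measurable_EFinP.
    have -> : (\int[gibbs Phi]_x `|(f3 x)%:E| = \int[gibbs Phi]_x (f3 x)%:E)%E.
      apply: (@eq_integral _ _ _ (gibbs_measure cPhi)) => x _; by rewrite /= ger0_norm.
    by rewrite lt_neqAle Ifin leey.
  move=> /(gibbs_integrable cPhi Zz z0).
  by under eq_fun do rewrite E3.
apply: (@entropy_le_legendre_lebesgue R n Phi Phi_C1 Phi_strictly_convex Phi_even Phi_superlinear
  Phi_ge0 Phi0 g a e A z Y) => //.
- exact: ltW.
- exact: ltW.
- apply: EFin_inj; rewrite -[LHS]mule1 -eg1 (gibbs_integral cPhi Zz z0 ieg).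
  rewrite /Rintegral fineK; last exact: integrable_fin_num.
  by apply: eq_integral => x _; rewrite /= mexpD.
- apply: EFin_inj; rewrite EFinM EK /entropy entE (gibbs_integral cPhi Zz z0 ient).
  rewrite /Rintegral fineK; last exact: integrable_fin_num.
  by apply: eq_integral => x _; rewrite /= mulrA mexpD.
- apply: EFin_inj; rewrite EFinM IK (ge0_gibbs_integral cPhi Zz z0)//.
  rewrite /Rintegral fineK; last exact: integrable_fin_num.
  by apply: eq_integral => x _; rewrite /= E3.
- have -> : z = 4 * th * Y by rewrite /th; field; rewrite gt_eqF.
  rewrite ler_pM2r// ler_pM2l//.
  have -> : e * A = th / 2 by rewrite /e; field; rewrite gt_eqF.
  lra.
- by rewrite -lee_fin EK.
Qed.
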